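(* (Deligne's Conjecture for module-algebras.) Let $H$ be a $K$-bialgebra and $A$ an $H$-module-algebra. The Hopf-Hochschild cochain complex $\mathrm{CH}^*_{\mathrm{Hopf}}(A,A)$ of $A$ is an algebra over the McClure-Smith operad $\mathcal{H}$ that is a chain model for the little squares operad $\mathcal{C}_2$.
   Context: Conventions. $K$ is a fixed field; vector spaces and tensor products are over $K$. $H$ is a $K$-bialgebra (associative, unital, coassociative, counital) with counit $\varepsilon$ and Sweedler notation $\Delta(b)=\sum b_{(1)}\otimes b_{(2)}$, etc. $A$ is an associative unital $K$-algebra with unit $1$. $A$ is an $H$-module-algebra: $A$ is an $H$-module with $b(a_1a_2)=\sum(b_{(1)}a_1)(b_{(2)}a_2)$ and $b(1)=\varepsilon(b)1$ for $b\in H$, $a_1,a_2\in A$. Write $x_{i,j}$ for the sequence $x_i,\dots,x_j$. Crossed product algebra. $X=A\otimes A\otimes H$ with the associative unital multiplication $(a_1\otimes a_1'\otimes b^1)(a_2\otimes a_2'\otimes b^2)=\sum a_1(b^1_{(1)}a_2)\otimes(b^1_{(3)}a_2')a_1'\otimes b^1_{(2)}b^2$. $A$ is an $X$-module by $(a\otimes a'\otimes b)a_0=a(ba_0)a'$, and $A^{\otimes(n+2)}$ is an $X$-module by $(a\otimes a'\otimes b)(a_0\otimes\cdots\otimes a_{n+1})=\sum a(b_{(1)}a_0)\otimes b_{(2)}a_1\otimes\cdots\otimes b_{(n+1)}a_n\otimes(b_{(n+2)}a_{n+1})a'$. Hopf-Hochschild complex. $\mathrm{CB}_*(A)$ is the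 chain complex with $\mathrm{CB}_n(A)=A^{\otimes(n+2)}$ and differential $d_n^{\mathrm{CB}}=\sum_{j=0}^n(-1)^j\partial_j$, where $\partial_j(a_0\otimes\cdots\otimes a_{n+1})=a_0\otimes\cdots\otimes(a_ja_{j+1})\otimes\cdots\otimes a_{n+1}$; it is a chain complex of $X$-modules. The Hopf-Hochschild cochain complex of $A$ with coefficients in $A$ is $(\mathrm{CH}^*_{\mathrm{Hopf}}(A,A),d_{\mathrm{CH}})=\mathrm{Hom}_X((\mathrm{CB}_*(A),d^{\mathrm{CB}}),A)$. Brace algebra with multiplication. For a graded vector space $V=\bigoplus_{n\ge1}V^n$ and $x\in V^n$ put $\deg x=n$, $|x|=n-1$. A brace algebra is such a $V$ with brace operations $x\{x_1,\dots,x_n\}$ of degree $-n$ satisfying $$x\{x_{1,m}\}\{y_{1,n}\}=\sum(-1)^{\varepsilon}x\{y_{1,i_1},x_1\{y_{i_1+1,j_1}\},y_{j_1+1},\dots,y_{i_m},x_m\{y_{i_m+1,j_m}\},y_{j_m+1,n}\},$$ the sum over $0\le i_1\le j_1\le\cdots\le i_m\le j_m\le n$, with $\varepsilon=\sum_{p=1}^m\left(|x_p|\sum_{q=1}^{i_p}|y_q|\right)$ (with the convention $x\{\}=x$). A multiplication on a brace algebra $V$ is an element $m\in V^2$ with $m\{m\}=0$; then $(V,m)$ is called a brace algebra with multiplication. McClure-Smith operad. $\mathcal{C}_2$ is May's little squares operad. $\mathcal{H}$ is the operad, used by McClure and Smith in their solution of Deligne's Conjecture, whose algebras are the brace algebras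 with multiplication. McClure and Smith showed that $\mathcal{H}$ is quasi-isomorphic to the chain operad $\mathcal{S}$ obtained from $\mathcal{C}_2$ by applying the singular chain functor; this is the sense in which $\mathcal{H}$ is a chain model for $\mathcal{C}_2$. *)

(* Defs.v *)
From HB Require Import structures.
From mathcomp Require Import all_boot all_algebra.
From mathcomp Require Import boolp functions.
From mathcomp Require Import generic_quotient.

Set Implicit Arguments.
Unset Strict Implicit.
Unset Printing Implicit Defensive.

Import GRing.Theory.
Local Open Scope ring_scope.
Local Open Scope quotient_scope.

(* [linear], keyed on the two [lmodType] structures: unification copes with it
   better on tensor powers. *)
Definition is_linear (K : fieldType) (U V : lmodType K) (f : U -> V) :=
  linear f.

Definition is_bilinear (K : fieldType) (U V W : lmodType K) (f : U -> V -> W) :=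
  (forall v, is_linear (f^~ v)) /\ (forall u, is_linear (f u)).

Section Tensor.
Variables (K : fieldType) (U V : lmodType K).
Implicit Types (s t : seq (U * V)) (c : K).

(* The list [(u_1, v_1); ...; (u_n, v_n)] stands for the sum of the u_i (x) v_i.
   Two lists name the same tensor iff no bilinear map tells them apart, so the
   quotient has the universal property of U (x) V; see [tens_liftE] below. *)
Definition tens_eq s t : Prop :=
  forall (W : lmodType K) (f : U -> V -> W), is_bilinear f ->
  \sum_(p <- s) f p.1 p.2 = \sum_(p <- t) f p.1 p.2.

Definition tens_eqb s t : bool := `[< tens_eq s t >].

Lemma tens_eqb_refl : reflexive tens_eqb.
Proof. by move=> s; apply/asboolP. Qed.

Lemma tens_eqb_sym : symmetric tens_eqb.
Proof. by move=> s t; apply/asboolP/asboolP => h W f bf; rewrite h. Qed.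

Lemma tens_eqb_trans : transitive tens_eqb.
Proof.
move=> s t r /asboolP h1 /asboolP h2; apply/asboolP => W f bf.
by rewrite h1 // h2.
Qed.

Canonical tens_equiv :=
  EquivRel tens_eqb tens_eqb_refl tens_eqb_sym tens_eqb_trans.

Definition tens := {eq_quot tens_equiv}.

HB.instance Definition _ := Choice.on tens.
HB.instance Definition _ := EqQuotient.on tens.

Lemma tensP s t : reflect (tens_eq s t) (\pi_tens s == \pi_tens t).
Proof. by rewrite piE; apply: asboolP. Qed.

Lemma tens_repr s : tens_eq (repr (\pi_tens s)) s.
Proof. by apply/tensP; rewrite reprK. Qed.

Definition tens_zero : tens := \pi_tens [::].
Definition tens_scale c (x : tens) : tens :=
  \pi_tens [seq (c *: p.1, p.2) | p <- repr x].
Definition tens_opp (x : tens) : tens := tens_scale (-1) x.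
Definition tens_add (x y : tens) : tens := \pi_tens (repr x ++ repr y).

Section Value.
Variables (W : lmodType K) (f : U -> V -> W).

(* The linear map U (x) V -> W induced by f; it does not depend on the chosen
   representative when f is bilinear. *)
Definition tens_lift (x : tens) : W := \sum_(p <- repr x) f p.1 p.2.

Hypothesis bf : is_bilinear f.

Lemma tens_lift_pi s : tens_lift (\pi_tens s) = \sum_(p <- s) f p.1 p.2.
Proof. exact: tens_repr. Qed.

Lemma tens_lift0 : tens_lift tens_zero = 0.
Proof. by rewrite tens_lift_pi big_nil. Qed.

Lemma tens_liftZ c x : tens_lift (tens_scale c x) = c *: tens_lift x.
Proof.
rewrite tens_lift_pi big_map /tens_lift scaler_sumr; apply: eq_bigr => p _ /=.
have := bf.1 p.2 c p.1 0; have := bf.1 p.2 (-1) 0 0.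
by rewrite !scaler0 !addr0 scaleN1r addNr => ->; rewrite addr0.
Qed.

Lemma tens_liftD x y : tens_lift (tens_add x y) = tens_lift x + tens_lift y.
Proof. by rewrite tens_lift_pi big_cat. Qed.

End Value.

Lemma tens_ext x y :
  (forall (W : lmodType K) (f : U -> V -> W), is_bilinear f ->
     tens_lift f x = tens_lift f y) -> x = y.
Proof.
move=> h; rewrite -[x]reprK -[y]reprK; apply/eqP/tensP => W f bf.
exact: h.
Qed.

Fact tens_addA : associative tens_add.
Proof.
by move=> x y z; apply: tens_ext => W f bf; rewrite !tens_liftD // addrA.
Qed.
Fact tens_addC : commutative tens_add.
Proof.
by move=> x y; apply: tens_ext => W f bf; rewrite !tens_liftD // addrC.
Qed.
Fact tens_add0 : left_id tens_zero tens_add.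
Proof.
by move=> x; apply: tens_ext => W f bf;
  rewrite tens_liftD // tens_lift0 // add0r.
Qed.
Fact tens_addN : left_inverse tens_zero tens_opp tens_add.
Proof.
move=> x; apply: tens_ext => W f bf.
by rewrite tens_liftD // tens_liftZ // tens_lift0 // scaleN1r addNr.
Qed.

HB.instance Definition _ :=
  GRing.isZmodule.Build tens tens_addA tens_addC tens_add0 tens_addN.

Fact tens_scaleA a b x : tens_scale a (tens_scale b x) = tens_scale (a * b) x.
Proof. by apply: tens_ext => W f bf; rewrite !tens_liftZ // scalerA. Qed.
Fact tens_scale1 : left_id 1 tens_scale.
Proof.
by move=> x; apply: tens_ext => W f bf; rewrite tens_liftZ // scale1r.
Qed.
Fact tens_scaleDr : right_distributive tens_scale +%R.
Proof.
move=> a x y; apply: tens_ext => W f bf.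
by rewrite [RHS]tens_liftD // !tens_liftZ // tens_liftD // scalerDr.
Qed.
Fact tens_scaleDl x : {morph tens_scale^~ x : a b / a + b}.
Proof.
move=> a b; apply: tens_ext => W f bf.
by rewrite [RHS]tens_liftD // !tens_liftZ // scalerDl.
Qed.

HB.instance Definition _ := GRing.Zmodule_isLmodule.Build K tens
  tens_scaleA tens_scale1 tens_scaleDr tens_scaleDl.

Definition tpure (u : U) (v : V) : tens := \pi_tens [:: (u, v)].

Lemma tens_liftE (W : lmodType K) (f : U -> V -> W) u v :
  is_bilinear f -> tens_lift f (tpure u v) = f u v.
Proof. by move=> bf; rewrite tens_lift_pi // big_seq1. Qed.

Lemma tens_lift_linear (W : lmodType K) (f : U -> V -> W) :
  is_bilinear f -> is_linear (tens_lift f).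
Proof. by move=> bf a x y; rewrite tens_liftD // tens_liftZ. Qed.

Lemma tpure_bilinear : is_bilinear tpure.
Proof.
by split=> [v|u] a x y; apply: tens_ext => W f bf;
  rewrite [RHS]tens_liftD // tens_liftZ // !tens_liftE //;
  [apply: bf.1 | apply: bf.2].
Qed.

Lemma tens_sum_pure (x : tens) : x = \sum_(p <- repr x) tpure p.1 p.2.
Proof.
rewrite -{1}[x]reprK; elim: (repr x) => [|[u v] s IH]; first by rewrite big_nil.
rewrite big_cons -IH; apply: tens_ext => W f bf.
by rewrite tens_liftD // !tens_lift_pi // big_cons big_seq1.
Qed.

End Tensor.

(* The library's [algType K] imposes 1 != 0. The module-algebra A and the crossed
   product X may be zero, hence this variant. *)
HB.mixin Record isUnitalAlgebra (K : fieldType) A of GRing.Lmodule K A := {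
  amul : A -> A -> A;
  aone : A;
  amul_bilinear : is_bilinear amul;
  amulA : associative amul;
  amul1a : left_id aone amul;
  amula1 : right_id aone amul
}.

#[short(type="unitalAlgType")]
HB.structure Definition UnitalAlgebra (K : fieldType) :=
  {A of GRing.Lmodule K A & isUnitalAlgebra K A}.

Arguments aone {K s}.

Declare Scope ualg_scope.
Notation "x ** y" := (amul x y) (at level 40, left associativity) : ualg_scope.
Local Open Scope ualg_scope.

HB.mixin Record isBialgebra (K : fieldType) H of GRing.Algebra K H := {
  comul : H -> tens H H;
  counit : H -> K;
  comul_linear : is_linear comul;
  counit_linear : scalar counit;
  comul_coassoc : forall b : H,
    tens_lift (fun b1 b2 => tens_lift (fun b11 b12 =>
      tpure b11 (tpure b12 b2)) (comul b1)) (comul b) =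
    tens_lift (fun b1 b2 => tpure b1 (comul b2)) (comul b);
  comul_counitl : forall b : H,
    tens_lift (fun b1 b2 => counit b1 *: b2) (comul b) = b;
  comul_counitr : forall b : H,
    tens_lift (fun b1 b2 => counit b2 *: b1) (comul b) = b;
  comulM : forall b c : H, comul (b * c) =
    tens_lift (fun b1 b2 => tens_lift (fun c1 c2 =>
      tpure (b1 * c1) (b2 * c2)) (comul c)) (comul b);
  comul1 : comul 1 = tpure 1 1;
  counitM : forall b c : H, counit (b * c) = counit b * counit c;
  counit1 : counit 1 = 1
}.

#[short(type="bialgType")]
HB.structure Definition Bialgebra (K : fieldType) :=
  {H of GRing.Algebra K H & isBialgebra K H}.

HB.mixin Record isModuleAlgebra (K : fieldType) (H : bialgType K) A
    of UnitalAlgebra K A := {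
  act : H -> A -> A;
  act_bilinear : is_bilinear act;
  act_mul : forall (b c : H) (a : A), act (b * c) a = act b (act c a);
  act_one : forall a : A, act 1 a = a;
  act_prod : forall (b : H) (a1 a2 : A), act b (a1 ** a2) =
    tens_lift (fun b1 b2 => act b1 a1 ** act b2 a2) (comul b);
  act_unit : forall b : H, act b aone = counit b *: (aone : A)
}.

#[short(type="modAlgType")]
HB.structure Definition ModuleAlgebra (K : fieldType) (H : bialgType K) :=
  {A of UnitalAlgebra K A & isModuleAlgebra K H A}.

Section LinearBase.
Variables (K : fieldType) (U V : lmodType K).

Lemma lin0 (f : U -> V) : is_linear f -> f 0 = 0.
Proof. by move=> lf; have := lf (-1) 0 0; rewrite scaler0 addr0 scaleN1r addNr. Qed.

Lemma lin_zero : is_linear (fun _ : U => 0 : V).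
Proof. by move=> k x y; rewrite scaler0 addr0. Qed.

Lemma linZ (f : U -> V) c x : is_linear f -> f (c *: x) = c *: f x.
Proof. by move=> lf; have := lf c x 0; rewrite (lin0 lf) !addr0. Qed.

Lemma linD (f : U -> V) x y : is_linear f -> f (x + y) = f x + f y.
Proof. by move=> lf; have := lf 1 x y; rewrite !scale1r. Qed.

Lemma lin_sum I (r : seq I) (P : pred I) (F : I -> U) (f : U -> V) : is_linear f ->
  f (\sum_(i <- r | P i) F i) = \sum_(i <- r | P i) f (F i).
Proof.
move=> lf; elim/big_rec2: _ => [|i y1 y2 _ <-]; first exact: lin0.
exact: linD.
Qed.

End LinearBase.

Section Linearity.
Variables (K : fieldType) (Z U V W T : lmodType K).

Lemma lin_id : is_linear (fun z : Z => z).
Proof. by []. Qed.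

Lemma lin_bill (f : U -> V -> W) (g : Z -> U) v :
  is_bilinear f -> is_linear g -> is_linear (fun z => f (g z) v).
Proof. by move=> bf lg a x y; rewrite lg bf.1. Qed.

Lemma lin_bilr (f : U -> V -> W) (g : Z -> V) u :
  is_bilinear f -> is_linear g -> is_linear (fun z => f u (g z)).
Proof. by move=> bf lg a x y; rewrite lg bf.2. Qed.

Lemma lin_comp (f : U -> V) (g : Z -> U) :
  is_linear f -> is_linear g -> is_linear (fun z => f (g z)).
Proof. by move=> lf lg a x y; rewrite lg lf. Qed.

Lemma lin_liftl (F : Z -> U -> V -> W) t :
  (forall u v, is_linear (fun z => F z u v)) -> is_linear (fun z => tens_lift (F z) t).
Proof.
move=> lF a x y; rewrite /tens_lift scaler_sumr -big_split.
by apply: eq_bigr => p _; rewrite lF.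
Qed.

Lemma lin_liftr (f : U -> V -> W) (g : Z -> tens U V) :
  is_bilinear f -> is_linear g -> is_linear (fun z => tens_lift f (g z)).
Proof. by move=> bf lg a x y; rewrite lg tens_lift_linear. Qed.

Lemma lin_scale c (g : Z -> U) : is_linear g -> is_linear (fun z => c *: g z).
Proof. by move=> lg a x y; rewrite lg scalerDr !scalerA mulrC. Qed.

Lemma eq_lift (f g : U -> V -> W) t :
  (forall u v, f u v = g u v) -> tens_lift f t = tens_lift g t.
Proof. by move=> e; apply: eq_bigr. Qed.

Lemma lift_lin (f : U -> V -> W) (g : W -> T) t :
  is_linear g -> g (tens_lift f t) = tens_lift (fun u v => g (f u v)) t.
Proof. by move=> lg; rewrite /tens_lift (lin_sum _ _ _ lg). Qed.

Lemma tens_lin_ext (f g : tens U V -> W) : is_linear f -> is_linear g ->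
  (forall u v, f (tpure u v) = g (tpure u v)) -> f =1 g.
Proof.
move=> lf lg e t; rewrite (tens_sum_pure t) !lin_sum //.
exact: eq_bigr.
Qed.

End Linearity.

Lemma lift_swap (K : fieldType) (U V U' V' W : lmodType K)
    (F : U -> V -> U' -> V' -> W) s t :
  tens_lift (fun u v => tens_lift (F u v) t) s =
  tens_lift (fun u' v' => tens_lift (fun u v => F u v u' v') s) t.
Proof. exact: exchange_big. Qed.

Lemma lin_counit (K : fieldType) (H : bialgType K) (Z U : lmodType K)
    (g : Z -> H) (v : U) :
  is_linear g -> is_linear (fun z => counit (g z) *: v).
Proof. by move=> lg a x y; rewrite lg counit_linear scalerDl -scalerA. Qed.

Lemma mul_bilinear (K : fieldType) (H : algType K) :
  is_bilinear (fun b c : H => b * c).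
Proof.
split=> [c|b] a x y; first by rewrite mulrDl scalerAl.
by rewrite mulrDr scalerAr.
Qed.

Ltac lin_step := intros; first
  [ exact: lin_id
  | split; intro
  | assumption
  | apply: lin_liftr
  | apply: lin_liftl
  | apply: (lin_bill _ (@tpure_bilinear _ _ _))
  | apply: (lin_bilr _ (@tpure_bilinear _ _ _))
  | apply: (lin_bill _ (@act_bilinear _ _ _))
  | apply: (lin_bilr _ (@act_bilinear _ _ _))
  | apply: (lin_bill _ (@amul_bilinear _ _))
  | apply: (lin_bilr _ (@amul_bilinear _ _))
  | apply: (lin_bill _ (@mul_bilinear _ _))
  | apply: (lin_bilr _ (@mul_bilinear _ _))
  | apply: (lin_comp (@comul_linear _ _))
  | apply: lin_counit
  | apply: lin_scale ].
Ltac lin := repeat lin_step.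

Section Sweedler.
Variables (K : fieldType) (H : bialgType K) (W : lmodType K).
Implicit Types b c : H.

Lemma coassoc (F : H -> H -> H -> W) b :
  (forall y z, is_linear (fun x => F x y z)) ->
  (forall x z, is_linear (fun y => F x y z)) ->
  (forall x y, is_linear (fun z => F x y z)) ->
  tens_lift (fun b1 b2 => tens_lift (fun b11 b12 => F b11 b12 b2) (comul b1))
    (comul b) =
  tens_lift (fun b1 b2 => tens_lift (fun b21 b22 => F b1 b21 b22) (comul b2))
    (comul b).
Proof.
move=> l1 l2 l3.
have bF x : is_bilinear (F x) by lin; [apply: l2|apply: l3].
have bG : is_bilinear (fun x => tens_lift (F x)).
  by split=> [v|u]; [apply: lin_liftl => ? ?; apply: l1|apply: tens_lift_linear].
have /(congr1 (tens_lift (fun x => tens_lift (F x)))) := comul_coassoc b.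
rewrite !(lift_lin _ _ (tens_lift_linear bG)).
under eq_lift => b1 b2.
  rewrite (lift_lin _ _ (tens_lift_linear bG)).
  under eq_lift => b11 b12 do rewrite !tens_liftE //.
  over.
by move=> ->; apply: eq_lift => u v; rewrite tens_liftE.
Qed.

Lemma counitl (g : H -> W) b : is_linear g ->
  tens_lift (fun b1 b2 => counit b1 *: g b2) (comul b) = g b.
Proof.
move=> lg; rewrite -{2}(comul_counitl b) lift_lin //.
by apply: eq_lift => u v; rewrite linZ.
Qed.

Lemma counitr (g : H -> W) b : is_linear g ->
  tens_lift (fun b1 b2 => counit b2 *: g b1) (comul b) = g b.
Proof.
move=> lg; rewrite -{2}(comul_counitr b) lift_lin //.
by apply: eq_lift => u v; rewrite linZ.
Qed.

Lemma comul_mul (F : H -> H -> W) b c : is_bilinear F ->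
  tens_lift F (comul (b * c)) =
  tens_lift (fun b1 b2 => tens_lift (fun c1 c2 => F (b1 * c1) (b2 * c2))
    (comul c)) (comul b).
Proof.
move=> bF; rewrite comulM lift_lin; last exact: tens_lift_linear.
apply: eq_lift => b1 b2; rewrite lift_lin; last exact: tens_lift_linear.
by apply: eq_lift => c1 c2; rewrite tens_liftE.
Qed.

Lemma comul_one (F : H -> H -> W) : is_bilinear F ->
  tens_lift F (comul 1) = F 1 1.
Proof. by move=> bF; rewrite comul1 tens_liftE. Qed.

End Sweedler.

(* sum F b_(1) b_(2) b_(3) *)
Definition sweedler3 (K : fieldType) (H : bialgType K) (W : lmodType K)
    (F : H -> H -> H -> W) (b : H) : W :=
  tens_lift (fun p q => tens_lift (F p) (comul q)) (comul b).

Section Sweedler3.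
Variables (K : fieldType) (H : bialgType K) (W : lmodType K).
Implicit Types b c : H.

Lemma eq_sweedler3 (F G : H -> H -> H -> W) b :
  (forall p q r, F p q r = G p q r) -> sweedler3 F b = sweedler3 G b.
Proof. by move=> e; apply: eq_lift => ? ?; apply: eq_lift => ? ?. Qed.

Lemma sweedler3_swap (U V : lmodType K) (G : U -> V -> H -> H -> H -> W) t b :
  tens_lift (fun u v => sweedler3 (G u v) b) t =
  sweedler3 (fun p q r => tens_lift (fun u v => G u v p q r) t) b.
Proof. by rewrite /sweedler3 lift_swap; apply: eq_lift => ? ?; rewrite lift_swap. Qed.

Lemma sweedler3_lin (Z : lmodType K) (g : W -> Z) (F : H -> H -> H -> W) b :
  is_linear g -> g (sweedler3 F b) = sweedler3 (fun p q r => g (F p q r)) b.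
Proof. by move=> lg; rewrite /sweedler3 lift_lin //; apply: eq_lift => ? ?; rewrite lift_lin. Qed.

Lemma sweedler3_mul (F : H -> H -> H -> W) b c :
  (forall y z, is_linear (fun x => F x y z)) ->
  (forall x z, is_linear (fun y => F x y z)) ->
  (forall x y, is_linear (F x y)) ->
  sweedler3 F (b * c) = sweedler3 (fun p q r => sweedler3 (fun u v w =>
    F (p * u) (q * v) (r * w)) c) b.
Proof.
move=> l1 l2 l3; rewrite /sweedler3.
have bF x : is_bilinear (F x) by split=> ?; [apply: l2|apply: l3].
rewrite comul_mul; last first.
  split=> [y|x]; first by apply: lin_liftl => ? ?; apply: l1.
  by apply: lin_liftr => //; lin.
apply: eq_lift => p b'; rewrite [RHS]lift_swap.
apply: eq_lift => u c'; rewrite comul_mul //.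
Qed.

Lemma sweedler5 (G : H -> H -> H -> H -> H -> W) b :
  (forall q r s t, is_linear (fun p => G p q r s t)) ->
  (forall p r s t, is_linear (fun q => G p q r s t)) ->
  (forall p q s t, is_linear (fun r => G p q r s t)) ->
  (forall p q r t, is_linear (fun s => G p q r s t)) ->
  (forall p q r s, is_linear (G p q r s)) ->
  sweedler3 (fun p r s => tens_lift (fun p1 p2 => tens_lift (fun s1 s2 =>
    G p1 p2 r s1 s2) (comul s)) (comul p)) b =
  sweedler3 (fun p r s => sweedler3 (fun r1 r2 r3 => G p r1 r2 r3 s) r) b.
Proof.
move=> l1 l2 l3 l4 l5; rewrite /sweedler3.
under eq_lift => p q do rewrite lift_swap.
rewrite (coassoc (F := fun p1 p2 q => tens_lift (fun r s =>
  tens_lift (fun s1 s2 => G p1 p2 r s1 s2) (comul s)) (comul q))); first last.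
- by lin; intros; first [exact: l3|exact: l4|exact: l5].
- by lin; apply: l2.
- by lin; apply: l1.
apply: eq_lift => p q.
rewrite (coassoc (F := fun r1 r' s => tens_lift (fun r2 r3 => G p r1 r2 r3 s) (comul r')));
  [|by lin; intros; first [exact: l2|exact: l3|exact: l4|exact: l5]..].
apply: eq_lift => r1 c.
by rewrite (coassoc (F := fun r2 r3 s => G p r1 r2 r3 s)) //; lin.
Qed.

End Sweedler3.

Section CrossedProduct.
Variables (K : fieldType) (H : bialgType K) (A : modAlgType H).

Definition cross : Type := tens A (tens A H).
HB.instance Definition _ := GRing.Lmodule.on cross.

Definition xpure (a a' : A) (b : H) : cross := tpure a (tpure a' b).

Definition xlift (W : lmodType K) (F : A -> A -> H -> W) (x : cross) : W :=
  tens_lift (fun a y => tens_lift (F a) y) x.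

Definition xmul (x y : cross) : cross :=
  xlift (fun a1 a1' b1 => xlift (fun a2 a2' b2 =>
    sweedler3 (fun p q r =>
      xpure (a1 ** act p a2) (act r a2' ** a1') (q * b2)) b1) y) x.

Definition xone : cross := xpure aone aone 1.

Lemma lin_xpure1 (Z : lmodType K) (g : Z -> A) a' b :
  is_linear g -> is_linear (fun z => xpure (g z) a' b).
Proof. exact: (lin_bill _ (tpure_bilinear A (tens A H))). Qed.

Lemma lin_xpure2 (Z : lmodType K) (g : Z -> A) a b :
  is_linear g -> is_linear (fun z => xpure a (g z) b).
Proof.
move=> lg; apply: (lin_bilr _ (tpure_bilinear A (tens A H))).
by apply: (lin_bill _ (tpure_bilinear A H)).
Qed.

Lemma lin_xpure3 (Z : lmodType K) (g : Z -> H) a a' :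
  is_linear g -> is_linear (fun z => xpure a a' (g z)).
Proof.
move=> lg; apply: (lin_bilr _ (tpure_bilinear A (tens A H))).
by apply: (lin_bilr _ (tpure_bilinear A H)).
Qed.

Ltac linx := repeat first
  [ lin_step
  | intros;
    first [apply: lin_xpure1 | apply: lin_xpure2 | apply: lin_xpure3] ].

Lemma xlift_linear (W : lmodType K) (F : A -> A -> H -> W) :
  (forall a' b, is_linear (fun a => F a a' b)) ->
  (forall a b, is_linear (fun a' => F a a' b)) ->
  (forall a a', is_linear (F a a')) -> is_linear (xlift F).
Proof.
move=> l1 l2 l3; apply: tens_lift_linear; split=> [y|a].
  by apply: lin_liftl => ? ?; apply: l1.
by apply: tens_lift_linear; split=> [b|a']; [apply: l2|apply: l3].
Qed.

Lemma xliftE (W : lmodType K) (F : A -> A -> H -> W) a a' b :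
  (forall a' b, is_linear (fun a => F a a' b)) ->
  (forall a b, is_linear (fun a' => F a a' b)) ->
  (forall a a', is_linear (F a a')) -> xlift F (xpure a a' b) = F a a' b.
Proof.
move=> l1 l2 l3; have bF u : is_bilinear (F u) by split=> ?; [apply: l2|apply: l3].
rewrite /xlift tens_liftE ?tens_liftE //; split=> [y|u].
  by apply: lin_liftl => ? ?; apply: l1.
exact: tens_lift_linear.
Qed.

Lemma cross_ext (W : lmodType K) (f g : cross -> W) : is_linear f -> is_linear g ->
  (forall a a' b, f (xpure a a' b) = g (xpure a a' b)) -> f =1 g.
Proof.
move=> lf lg e; apply: tens_lin_ext => // a.
have pl := (tpure_bilinear A (tens A H)).2 a.
apply: (tens_lin_ext (f := fun y => f (tpure a y)) (g := fun y => g (tpure a y))).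
- exact: (lin_comp lf pl).
- exact: (lin_comp lg pl).
- exact: e.
Qed.

Lemma xmul_pure a1 a1' b1 a2 a2' b2 :
  xmul (xpure a1 a1' b1) (xpure a2 a2' b2) =
  sweedler3 (fun p q r =>
    xpure (a1 ** act p a2) (act r a2' ** a1') (q * b2)) b1.
Proof. by rewrite /xmul !xliftE // /xlift /sweedler3; linx. Qed.

Lemma xmul_bilinear : is_bilinear xmul.
Proof. by rewrite /xmul /xlift /sweedler3; linx. Qed.

Lemma xmulA : associative xmul.
Proof.
have [bl br] := xmul_bilinear.
move=> x y z; move: x y z.
suff h a a' b c c' e g g' h :
    xmul (xpure a a' b) (xmul (xpure c c' e) (xpure g g' h)) =
    xmul (xmul (xpure a a' b) (xpure c c' e)) (xpure g g' h).
  move=> x y z; move: x; apply: cross_ext => [|| a a' b].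
  - exact: bl.
  - by apply: (lin_comp (bl _)); apply: bl.
  move: y; apply: cross_ext => [|| c c' e].
  - by apply: (lin_comp (br _)); apply: bl.
  - by apply: (lin_comp (bl _)); apply: br.
  move: z; apply: cross_ext => [|| g g' k].
  - by apply: (lin_comp (br _)); apply: br.
  - exact: br.
  exact: h.
rewrite !xmul_pure (sweedler3_lin _ _ (br _)) (sweedler3_lin _ _ (bl _)).
pose F b1 b2 b3 b4 b5 e1 e2 e3 :=
  xpure (a ** act b1 c ** act (b2 * e1) g)
        (act (b4 * e3) g' ** (act b5 c' ** a')) (b3 * e2 * h).
transitivity (sweedler3 (fun e1 e2 e3 => sweedler3 (fun p r s =>
  sweedler3 (fun q1 q2 q3 => F p q1 q2 q3 s e1 e2 e3) r) b) e).
  apply: eq_sweedler3 => e1 e2 e3; rewrite xmul_pure.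
  rewrite -(sweedler5 (G := fun p q r s t => F p q r s t e1 e2 e3));
    try by rewrite /F; linx.
  apply: eq_sweedler3 => p q r.
  rewrite act_prod (lift_lin _ _ (g := fun w => xpure (a ** w) _ _));
    last by linx.
  apply: eq_lift => b1 b2.
  rewrite act_prod (lift_lin _ _ (g := fun w => xpure _ (w ** _) _));
    last by linx.
  by apply: eq_lift => b4 b5; rewrite /F !amulA !act_mul mulrA.
transitivity (sweedler3 (fun p r s => sweedler3 (fun q1 q2 q3 =>
  sweedler3 (F p q1 q2 q3 s) e) r) b).
  rewrite {1}/sweedler3 [RHS]/sweedler3.
  under [RHS]eq_lift => p q.
    under eq_lift => r s.
      rewrite {1}/sweedler3.
      under eq_lift => q1 q' do rewrite sweedler3_swap.
      rewrite sweedler3_swap.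
      over.
    rewrite sweedler3_swap.
    over.
  by rewrite sweedler3_swap.
apply: eq_sweedler3 => p r s; rewrite xmul_pure sweedler3_mul //;
  by linx.
Qed.

Lemma xmul1x : left_id xone xmul.
Proof.
have [bl br] := xmul_bilinear.
apply: cross_ext => // a a' b; rewrite /xone xmul_pure /sweedler3 comul_one.
  rewrite comul_one; last by linx.
  by rewrite !act_one amul1a amula1 mul1r.
by linx.
Qed.

Lemma xmulx1 : right_id xone xmul.
Proof.
have [bl br] := xmul_bilinear.
apply: cross_ext => // a a' b; rewrite /xone xmul_pure /sweedler3.
transitivity (tens_lift (fun p q => counit p *: xpure a a' q) (comul b)).
  apply: eq_lift => p q.
  rewrite -(counitr (g := fun q => _ *: xpure a a' q));
    last by linx.
  apply: eq_lift => r s; rewrite !act_unit mulr1.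
  rewrite (linZ (f := fun w => xpure (a ** w) _ _));
    last by linx.
  rewrite (linZ (f := fun w => xpure _ (w ** _) _));
    last by linx.
  by rewrite amula1 amul1a !scalerA mulrC.
by rewrite counitl //; linx.
Qed.

HB.instance Definition _ := isUnitalAlgebra.Build K cross
  xmul_bilinear xmulA xmul1x xmulx1.

End CrossedProduct.

Section TensorPowers.
Variables (K : fieldType) (H : bialgType K) (A : modAlgType H).
Implicit Types (n j : nat) (a c : A) (b : H).

(* [tpow n] is the (n+1)-fold tensor power of A, so that CB_n(A) is [tpow n.+1]
   and A itself is [tpow 0]. *)
Fixpoint tpow n : lmodType K := if n is m.+1 then tens A (tpow m) else A.

(* a_0 (x) ... (x) a_n, for s = [a_0; ...; a_n] *)
Fixpoint tpures n (s : seq A) : tpow n :=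
  if n is m.+1 then tpure (head 0 s) (tpures m (behead s)) else head 0 s.

Definition lmult n a : tpow n -> tpow n :=
  match n with
  | 0 => fun t => a ** t
  | m.+1 => fun t => tens_lift (fun a0 u => tpure (a ** a0) u) t
  end.

Fixpoint rmult n a : tpow n -> tpow n :=
  match n with
  | 0 => fun t => t ** a
  | m.+1 => fun t => tens_lift (fun a0 u => tpure a0 (rmult a u)) t
  end.

(* b (a_0 (x) ... (x) a_n) = sum b_(1) a_0 (x) ... (x) b_(n+1) a_n *)
Fixpoint hact n b : tpow n -> tpow n :=
  match n with
  | 0 => fun t => act b t
  | m.+1 => fun t => tens_lift (fun b1 b2 =>
      tens_lift (fun a0 u => tpure (act b1 a0) (hact b2 u)) t) (comul b)
  end.

(* The X-module structure of all tensor powers at once: on [tpow 0] it reads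
     (a (x) a' (x) b) a_0 = a (b a_0) a',
   and on CB_n(A)
     (a (x) a' (x) b) (a_0 (x) ... (x) a_(n+1))
       = sum a (b_(1) a_0) (x) b_(2) a_1 (x) ... (x) (b_(n+2) a_(n+1)) a'. *)
Definition xact n (x : cross A) (t : tpow n) : tpow n :=
  xlift (fun a a' b => lmult a (rmult a' (hact b t))) x.

(* Multiplication of the tensor factors number j and j + 1; see [face_tpures]. *)
Fixpoint face j n : tpow n.+1 -> tpow n :=
  match j with
  | 0 => fun t => tens_lift (@lmult n) t
  | i.+1 =>
    match n with
    | 0 => fun=> 0
    | m.+1 => fun t => tens_lift (fun a0 u => tpure a0 (face i u)) t
    end
  end.

(* d_n : CB_n(A) -> CB_(n-1)(A); [dCB 0] is the augmentation A (x) A -> A, which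
   is not part of the complex. *)
Definition dCB n (t : tpow n.+1) : tpow n :=
  \sum_(j < n.+1) (-1) ^+ j *: face j t.

Lemma lmult_bilinear n : is_bilinear (@lmult n).
Proof. by case: n => [|n]; lin. Qed.

Lemma rmult_bilinear n : is_bilinear (@rmult n).
Proof.
elim: n => [|n [IH1 IH2]]; first by lin.
lin; first exact: IH1.
exact: IH2.
Qed.

Lemma hact_bilinear n : is_bilinear (@hact n).
Proof.
elim: n => [|n [IH1 IH2]]; first by lin.
lin; first exact: IH1.
exact: IH2.
Qed.

Lemma face_linear j n : is_linear (@face j n).
Proof.
elim: j n => [|j IH] n; first exact: (tens_lift_linear (lmult_bilinear n)).
case: n => [|n]; first exact: lin_zero.
apply: (tens_lift_linear (f := fun a0 u => tpure a0 (face j u))); split=> [u|c].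
  by lin.
exact: (lin_bilr _ (tpure_bilinear _ _) (IH n)).
Qed.

Lemma dCB_linear n : is_linear (@dCB n).
Proof.
move=> k x y; rewrite /dCB scaler_sumr -big_split /=; apply: eq_bigr => j _.
by rewrite face_linear scalerDr !scalerA mulrC.
Qed.

Ltac linh := repeat first
  [ lin_step
  | intros;
    first [ apply: lin_xpure1 | apply: lin_xpure2 | apply: lin_xpure3
          | apply: (lin_bill _ (lmult_bilinear _))
          | apply: (lin_bilr _ (lmult_bilinear _))
          | apply: (lin_bill _ (rmult_bilinear _))
          | apply: (lin_bilr _ (rmult_bilinear _))
          | apply: (lin_bill _ (hact_bilinear _))
          | apply: (lin_bilr _ (hact_bilinear _))
          | apply: (lin_comp (@face_linear _ _)) ] ].

Lemma lmult_pure n a c (u : tpow n) :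
  lmult a (tpure c u : tpow n.+1) = tpure (a ** c) u.
Proof. by rewrite /= tens_liftE //; linh. Qed.

Lemma rmult_pure n a c (u : tpow n) :
  rmult a (tpure c u : tpow n.+1) = tpure c (rmult a u).
Proof. by rewrite /= tens_liftE //; linh. Qed.

Lemma hact_pure n b c (u : tpow n) : hact b (tpure c u : tpow n.+1) =
  tens_lift (fun b1 b2 => tpure (act b1 c) (hact b2 u)) (comul b).
Proof. by apply: eq_lift => b1 b2; rewrite tens_liftE //; linh. Qed.

Lemma face0_pure n c (u : tpow n) : face 0 (tpure c u : tpow n.+1) = lmult c u.
Proof. by rewrite /= tens_liftE //; linh. Qed.

Lemma faceS_pure j n c (u : tpow n.+1) :
  face j.+1 (tpure c u : tpow n.+2) = tpure c (face j u).
Proof. by rewrite /= tens_liftE //; linh. Qed.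

Lemma tpow_ext n (W : lmodType K) (f g : tpow n.+1 -> W) :
  is_linear f -> is_linear g ->
  (forall c (u : tpow n), f (tpure c u) = g (tpure c u)) -> f =1 g.
Proof. exact: tens_lin_ext. Qed.

Lemma lmultM n a c (t : tpow n) : lmult (a ** c) t = lmult a (lmult c t).
Proof.
case: n t => [|n] t; first by rewrite /= amulA.
move: t; apply: tpow_ext => [||d u]; try by linh.
by rewrite !lmult_pure amulA.
Qed.

Lemma lmult1 n (t : tpow n) : lmult aone t = t.
Proof.
case: n t => [|n] t; first by rewrite /= amul1a.
by move: t; apply: tpow_ext => [||d u]; [linh..|rewrite lmult_pure amul1a].
Qed.

Lemma rmultM n a c (t : tpow n) : rmult (a ** c) t = rmult c (rmult a t).
Proof.
elim: n t => [|n IH] t; first by rewrite /= amulA.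
move: t; apply: tpow_ext => [||d u]; try by linh.
by rewrite !rmult_pure IH.
Qed.

Lemma rmult1 n (t : tpow n) : rmult aone t = t.
Proof.
elim: n t => [|n IH] t; first by rewrite /= amula1.
by move: t; apply: tpow_ext => [||d u]; [linh..|rewrite rmult_pure IH].
Qed.

Lemma lmult_rmult n a c (t : tpow n) :
  lmult a (rmult c t) = rmult c (lmult a t).
Proof.
case: n t => [|n] t; first by rewrite /= amulA.
move: t; apply: tpow_ext => [||d u]; try by linh.
by rewrite rmult_pure !lmult_pure rmult_pure.
Qed.

Lemma hactM n (b c : H) (t : tpow n) : hact (b * c) t = hact b (hact c t).
Proof.
elim: n b c t => [|n IH] b c t; first by rewrite /= act_mul.
move: t; apply: tpow_ext => [||d u]; try by linh.
rewrite !hact_pure comul_mul; last by linh.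
rewrite [RHS]lift_lin; last by apply: (hact_bilinear n.+1).2.
transitivity (tens_lift (fun c1 c2 : H => tens_lift (fun b1 b2 =>
    tpure (act b1 (act c1 d)) (hact b2 (hact c2 u))) (comul b)) (comul c));
  last by apply: eq_lift => c1 c2; rewrite hact_pure.
rewrite [RHS]lift_swap; apply: eq_lift => b1 b2; apply: eq_lift => c1 c2.
by rewrite act_mul IH.
Qed.

Lemma hact1 n (t : tpow n) : hact 1 t = t.
Proof.
elim: n t => [|n IH] t; first by rewrite /= act_one.
move: t; apply: tpow_ext => [||d u]; try by linh.
by rewrite hact_pure comul_one ?act_one ?IH //; linh.
Qed.

Lemma hact_lmult n b a (t : tpow n) : hact b (lmult a t) =
  tens_lift (fun b1 b2 => lmult (act b1 a) (hact b2 t)) (comul b).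
Proof.
case: n t => [|n] t; first by rewrite /= act_prod.
move: t; apply: tpow_ext => [||d u]; try by linh.
rewrite lmult_pure hact_pure.
transitivity (tens_lift (fun b1 b2 => tens_lift (fun p q =>
    tpure (act p a ** act q d) (hact b2 u)) (comul b1)) (comul b)).
  apply: eq_lift => b1 b2; rewrite act_prod.
  by rewrite (lift_lin _ _ (g := fun w => tpure w _)) //; linh.
rewrite coassoc; try by linh.
apply: eq_lift => b1 b2; rewrite hact_pure.
rewrite [RHS]lift_lin; last by apply: (lmult_bilinear n.+1).2.
by apply: eq_lift => p q; rewrite lmult_pure.
Qed.

Lemma hact_rmult n b a (t : tpow n) : hact b (rmult a t) =
  tens_lift (fun b1 b2 => rmult (act b2 a) (hact b1 t)) (comul b).
Proof.
elim: n b t => [|n IH] b t; first by rewrite /= act_prod.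
move: t; apply: tpow_ext => [||d u]; try by linh.
rewrite rmult_pure hact_pure.
transitivity (tens_lift (fun b1 b2 => tens_lift (fun p q =>
    tpure (act b1 d) (rmult (act q a) (hact p u))) (comul b2)) (comul b)).
  apply: eq_lift => b1 b2; rewrite IH.
  by rewrite (lift_lin _ _ (g := fun w => tpure _ w)) //; linh.
rewrite -(coassoc (F := fun b1 p q => tpure (act b1 d)
  (rmult (act q a) (hact p u)))); try by linh.
apply: eq_lift => b1 b2; rewrite hact_pure.
rewrite [RHS]lift_lin; last by apply: (rmult_bilinear n.+1).2.
by apply: eq_lift => p q; rewrite rmult_pure.
Qed.

Lemma xact_pure n a a' b (t : tpow n) :
  xact (xpure a a' b) t = lmult a (rmult a' (hact b t)).
Proof. by rewrite /xact xliftE //; linh. Qed.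

Lemma xact_bilinear n : is_bilinear (@xact n).
Proof. by rewrite /xact /xlift; linh. Qed.

Lemma xactM n (x y : cross A) (t : tpow n) :
  xact (x ** y) t = xact x (xact y t).
Proof.
have [bl br] := xact_bilinear n; have [ml mr] := @xmul_bilinear K H A.
move: x; apply: cross_ext => [||a a' b].
- by apply: (lin_comp (bl _)); apply: ml.
- exact: bl.
move: y; apply: cross_ext => [||c c' e].
- by apply: (lin_comp (bl _)); apply: mr.
- by apply: (lin_comp (br _)); apply: bl.
rewrite [_ ** _]xmul_pure (sweedler3_lin _ _ (bl t)) !xact_pure.
rewrite hact_lmult (lift_lin _ _ (g := fun w => lmult a (rmult a' w)));
  last by linh.
apply: eq_lift => p b2; rewrite hact_rmult.
rewrite (lift_lin _ _ (g := fun w => lmult a (rmult a' (lmult _ w))));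
  last by linh.
apply: eq_lift => q r.
by rewrite xact_pure lmultM rmultM hactM !lmult_rmult.
Qed.

Lemma xact1 n (t : tpow n) : xact (aone : cross A) t = t.
Proof. by rewrite [aone]/(xone A) xact_pure hact1 rmult1 lmult1. Qed.

Lemma face_lmult j n a (t : tpow n.+1) : face j (lmult a t) = lmult a (face j t).
Proof.
move: t; apply: tpow_ext => [||c u]; try by linh.
rewrite lmult_pure; case: j => [|j]; first by rewrite !face0_pure lmultM.
case: n u => [|n] u; first by rewrite /= (lin0 ((@amul_bilinear K A).2 a)).
by rewrite !faceS_pure lmult_pure.
Qed.

Lemma face_rmult j n a (t : tpow n.+1) : face j (rmult a t) = rmult a (face j t).
Proof.
elim: j n t => [|j IH] n; apply: tpow_ext => [||c u]; try by linh.
  by rewrite rmult_pure !face0_pure lmult_rmult.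
rewrite rmult_pure; case: n u => [|n] u.
  by rewrite /= (lin0 ((@amul_bilinear K A).1 a)).
by rewrite !faceS_pure rmult_pure IH.
Qed.

Lemma face_hact j n b (t : tpow n.+1) : face j (hact b t) = hact b (face j t).
Proof.
elim: j n b t => [|j IH] n b; apply: tpow_ext => [||c u]; try by linh.
  rewrite hact_pure face0_pure hact_lmult.
  rewrite (lift_lin _ _ (@face_linear 0 n)).
  by apply: eq_lift => b1 b2; rewrite face0_pure.
rewrite hact_pure; case: n u => [|n] u.
  by rewrite /= (lin0 ((@act_bilinear K H A).2 b)).
rewrite faceS_pure hact_pure (lift_lin _ _ (@face_linear j.+1 n.+1)).
by apply: eq_lift => b1 b2; rewrite faceS_pure IH.
Qed.

Lemma dCB_xact n (x : cross A) (t : tpow n.+1) :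
  dCB (xact x t) = xact x (dCB t).
Proof.
have [bl br] := xact_bilinear n; have [bl' _] := xact_bilinear n.+1.
move: x; apply: cross_ext => [||a a' b].
- exact: (lin_comp (@dCB_linear n) (bl' t)).
- exact: bl.
rewrite !xact_pure /dCB.
rewrite (lin_sum _ _ _ ((hact_bilinear n).2 b)).
rewrite (lin_sum _ _ _ ((rmult_bilinear n).2 a')).
rewrite (lin_sum _ _ _ ((lmult_bilinear n).2 a)).
apply: eq_bigr => j _.
rewrite (linZ _ _ ((hact_bilinear n).2 b)) (linZ _ _ ((rmult_bilinear n).2 a')).
by rewrite (linZ _ _ ((lmult_bilinear n).2 a)) face_lmult face_rmult face_hact.
Qed.

Lemma dCB_lmult n a (t : tpow n.+1) : dCB (lmult a t) = lmult a (dCB t).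
Proof.
rewrite /dCB (lin_sum _ _ _ ((lmult_bilinear n).2 a)); apply: eq_bigr => j _.
by rewrite (linZ _ _ ((lmult_bilinear n).2 a)) face_lmult.
Qed.

Lemma dCB_pure n c (u : tpow n.+1) :
  dCB (tpure c u : tpow n.+2) = lmult c u - tpure c (dCB u).
Proof.
rewrite /dCB big_ord_recl face0_pure expr0 scale1r; congr (_ + _).
have tl := (tpure_bilinear A (tpow n)).2 c.
rewrite (lin_sum _ _ _ tl) -sumrN; apply: eq_bigr => j _.
by rewrite faceS_pure exprS mulN1r scaleNr (linZ _ _ tl).
Qed.

Lemma dCB_dCB n (t : tpow n.+2) : dCB (dCB t) = 0.
Proof.
elim: n t => [|n IH]; apply: tpow_ext => [||c u].
- exact: (lin_comp (@dCB_linear _) (@dCB_linear _)).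
- exact: lin_zero.
- rewrite dCB_pure (linD _ _ (@dCB_linear 0)) -scaleN1r.
  rewrite (linZ _ _ (@dCB_linear 0)) scaleN1r dCB_lmult.
  by rewrite [dCB (tpure _ _)]/dCB big_ord1 face0_pure expr0 scale1r subrr.
- exact: (lin_comp (@dCB_linear _) (@dCB_linear _)).
- exact: lin_zero.
rewrite dCB_pure (linD _ _ (@dCB_linear _)) -scaleN1r.
rewrite (linZ _ _ (@dCB_linear _)) scaleN1r dCB_lmult dCB_pure IH.
by rewrite (lin0 ((tpure_bilinear A (tpow n)).2 c)) subr0 subrr.
Qed.

Lemma face_tpures n j (s : seq A) : (j <= n)%N -> size s = n.+2 ->
  face j (tpures n.+1 s) =
  tpures n (take j s ++ nth 0 s j ** nth 0 s j.+1 :: drop j.+2 s).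
Proof.
elim: j n s => [|j IH] n [|a [|c s]] // jn [sz].
  rewrite [tpures _ _]/= face0_pure /= drop0.
  by case: n {jn} sz => [|n] sz //; rewrite lmult_pure.
case: n jn sz => // n jn sz.
rewrite -[tpures n.+2 _]/(tpure a (tpures n.+1 (c :: s)) : tpow n.+2).
by rewrite faceS_pure IH //= sz.
Qed.

End TensorPowers.

Record cochainComplex (K : fieldType) := CochainComplex {
  cobj :> nat -> lmodType K;
  cdiff : forall n, cobj n -> cobj n.+1;
  cdiff_linear : forall n, is_linear (@cdiff n);
  cdiffK : forall n (x : cobj n), cdiff (cdiff x) = 0
}.

Section HopfHochschild.
Variables (K : fieldType) (H : bialgType K) (A : modAlgType H).
Implicit Types n : nat.

(* Hom_X(CB_n(A), A); the target A is the X-module [tpow A 0]. *)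
Definition is_cochain n (f : tpow A n.+1 -> A) : Prop :=
  is_linear f /\
  forall (x : cross A) t, f (xact x t) = xact x (f t : tpow A 0%N).

Definition cochain_pred n : {pred tpow A n.+1 -> A} :=
  fun f => `[< is_cochain f >].
Arguments cochain_pred : clear implicits.

Lemma cochain_submod n : submod_closed (cochain_pred n).
Proof.
have x0l x := (xact_bilinear A 0).2 x.
split=> [|k f g /asboolP[lf xf] /asboolP[lg xg]].
  by apply/asboolP; split=> [|x t]; [apply: lin_zero|rewrite (lin0 (x0l x))].
apply/asboolP; split=> [a u v|x t].
  rewrite -[LHS]/(k *: f (a *: u + v) + g (a *: u + v)) lf lg.
  rewrite -[RHS]/(a *: (k *: f u + g u) + (k *: f v + g v)).
  by rewrite !scalerDr !scalerA mulrC addrACA.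
rewrite -[LHS]/(k *: f (xact x t) + g (xact x t)) xf xg.
by rewrite -[RHS]/(xact x (k *: f t + g t : tpow A 0)) x0l.
Qed.

HB.instance Definition _ n :=
  GRing.isSubmodClosed.Build K (tpow A n.+1 -> A) (cochain_pred n)
    (cochain_submod n).

Record cochain n := Cochain {
  cochain_val :> tpow A n.+1 -> A;
  _ : cochain_val \in cochain_pred n
}.

HB.instance Definition _ n := [isSub for @cochain_val n].
HB.instance Definition _ n := [Choice of cochain n by <:].
HB.instance Definition _ n := [SubChoice_isSubLmodule of cochain n by <:].

Lemma cochainP n (f : cochain n) : is_cochain f.
Proof. by case: f => f /= /asboolP. Qed.

Lemma dCH_subproof n (f : cochain n) :
  (fun t : tpow A n.+2 => f (dCB t)) \in cochain_pred n.+1.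
Proof.
have [lf xf] := cochainP f; apply/asboolP; split=> [|x t].
  exact: (lin_comp lf (@dCB_linear _ _ A n.+1)).
by rewrite dCB_xact xf.
Qed.

Definition dCH n (f : cochain n) : cochain n.+1 := Cochain (dCH_subproof f).

Lemma dCH_linear n : is_linear (@dCH n).
Proof. by move=> k f g; apply/val_inj. Qed.

Lemma dCH_dCH n (f : cochain n) : dCH (dCH f) = 0.
Proof.
have [lf _] := cochainP f; apply/val_inj/funext => t /=.
by rewrite dCB_dCB (lin0 lf).
Qed.

Definition CH_Hopf : cochainComplex K :=
  CochainComplex dCH_linear dCH_dCH.

(* f(1 (x) a_1 (x) ... (x) a_n (x) 1), for s = [a_1; ...; a_n]. As f is X-linear,
   these values determine f. *)
Definition ceval n (f : CH_Hopf n) (s : seq A) : A :=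
  cochain_val f (tpures n.+1 (aone :: rcons s aone)).

End HopfHochschild.

Section BraceAlgebras.
Variables (K : fieldType) (V : nat -> lmodType K).

(* The graded space with component V n in degree n, through its homogeneous
   elements. The component in degree 0 is allowed: brace algebras graded in
   degrees >= 1 are those with V 0 = 0. *)
Definition helt := {n : nat & V n}.
Definition hom n (u : V n) : helt := Tagged V u.
Definition deg (x : helt) : nat := tag x.
Definition sdeg (x : helt) : int := (deg x)%:Z - 1.

(* [br x xs N] stands for the component in degree N of x{xs}. *)
Definition brace_op := helt -> seq helt -> forall N, V N.

(* x{xs} as a homogeneous element of degree deg x + sum deg x_i - n. *)
Definition hbrace (br : brace_op) (x : helt) (xs : seq helt) : helt :=
  hom (br x xs (deg x + \sum_(y <- xs) deg y - size xs)%N).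

(* For t = [i_1; j_1; ...; i_m; j_m], the sequence
   y_(pos+1), ..., y_(i_1), x_1{y_(i_1+1), ..., y_(j_1)}, y_(j_1+1), ...,
   y_(i_m), x_m{y_(i_m+1), ..., y_(j_m)}, y_(j_m+1), ..., y_n. *)
Fixpoint weave (br : brace_op) (pos : nat) (xs ys : seq helt) (t : seq nat) :
    seq helt :=
  match xs, t with
  | x :: xs', i :: j :: t' =>
      drop pos (take i ys) ++
      hbrace br x (drop i (take j ys)) :: weave br j xs' ys t'
  | _, _ => drop pos ys
  end.

(* sum_p |x_p| sum_(q <= i_p) |y_q|, where i_p is the entry number 2p of t when
   counting from 0 *)
Definition brace_sign (xs ys : seq helt) (t : seq nat) : int :=
  \sum_(p < size xs) (map sdeg xs)`_p *
    \sum_(y <- take (nth 0%N t p.*2) ys) sdeg y.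

Record braceAlgebra := BraceAlgebra {
  brace : brace_op;
  brace_degree : forall x xs N,
    (N + size xs)%N <> (deg x + \sum_(y <- xs) deg y)%N -> brace x xs N = 0;
  brace_linear_head : forall n xs N,
    is_linear (fun u : V n => brace (hom u) xs N);
  brace_linear_arg : forall x ys n zs N,
    is_linear (fun u : V n => brace x (ys ++ hom u :: zs) N);
  brace_nil : forall n (u : V n), brace (hom u) [::] n = u;
  brace_brace : forall x xs ys N,
    brace (hbrace brace x xs) ys N =
    \sum_(t : (size xs).*2.-tuple 'I_(size ys).+1 | sorted leq (map val t))
      (-1) ^ brace_sign xs ys (map val t) *:
        brace x (weave brace 0%N xs ys (map val t)) N
}.

Definition is_multiplication (B : braceAlgebra) (m : V 2%N) : Prop :=
  brace B (hom m) [:: hom m] 3%N = 0.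

Definition brace_diff (B : braceAlgebra) (m : V 2%N) n (x : V n) : V n.+1 :=
  brace B (hom m) [:: hom x] n.+1 -
    (-1) ^ sdeg (hom x) *: brace B (hom x) [:: hom m] n.+1.

End BraceAlgebras.

(* An algebra over the McClure-Smith operad on the complex C. The operad is the
   one whose algebras are the brace algebras with multiplication (V, m); as a
   complex, such an algebra carries the differential m{x} - (-1)^|x| x{m}. *)
Record mcClureSmithAlgebra (K : fieldType) (C : cochainComplex K) :=
    McClureSmithAlgebra {
  ms_brace :> braceAlgebra C;
  ms_mult : C 2%N;
  ms_multP : is_multiplication ms_brace ms_mult;
  ms_diff : forall n (x : C n), cdiff x = brace_diff ms_brace ms_mult x
}.

Section Composition.
Variables (K : fieldType) (H : bialgType K) (A : modAlgType H).
Local Notation helt := (helt (CH_Hopf A)).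

(* The mask e selects the arguments of a cochain that receive x_1, ..., x_n.
   [plug e xs s] is the list of all arguments obtained by distributing s, and
   [plug_sign e xs] is the sum of |x_p| times the number of arguments that
   follow the one receiving x_p. *)
Fixpoint plug (e : bitseq) (xs : seq helt) (s : seq A) : seq A :=
  match e, xs with
  | true :: e', x :: xs' =>
      ceval (tagged x) (take (deg x) s) :: plug e' xs' (drop (deg x) s)
  | false :: e', _ => head 0 s :: plug e' xs (behead s)
  | _, _ => [::]
  end.

Fixpoint plug_sign (e : bitseq) (xs : seq helt) : int :=
  match e, xs with
  | true :: e', x :: xs' => sdeg x * (size e')%:Z + plug_sign e' xs'
  | false :: e', _ => plug_sign e' xs
  | _, _ => 0
  end.

(* sum +- x(a_1, ..., x_1(...), ..., x_n(...), ..., a_N) *)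
Definition compose (x : helt) (xs : seq helt) (s : seq A) : A :=
  \sum_(e : (deg x).-tuple bool | count id e == size xs)
    (-1) ^ plug_sign e xs *: ceval (tagged x) (plug e xs s).

End Composition.

(* Main.v *)
Require Import Defs.
From mathcomp Require Import all_boot all_algebra.
From mathcomp Require Import boolp zify ring.

Set Implicit Arguments.
Unset Strict Implicit.
Unset Printing Implicit Defensive.

Import GRing.Theory.
Local Open Scope ring_scope.
Local Open Scope ualg_scope.

(** By X-linearity, a cochain f in Hom_X(CB_n(A), A) satisfies
      f(a_0 (x) ... (x) a_(n+1)) = a_0 f(1 (x) a_1 (x) ... (x) a_n (x) 1) a_(n+1),
    and H acts on 1 by the counit. So n-cochains are the same as n-linear
    functions F on A that are equivariant, meaning that
      b F(a_1, ..., a_n) = sum F(b_(1) a_1, ..., b_(n) a_n);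
    see [ceval_inj], [ceval_multilinear], [ceval_equivariant] and
    [cochain_exists].

    Insertion of functions into arguments of another function, with the order of
    all arguments kept, preserves equivariance because the comultiplication is
    coassociative ([sweedler_sum_cat], [graft_equivariant]). Hence the signed
    sums [compose], which are the braces of Hochschild cochains, define braces
    on Hopf-Hochschild cochains. The product of A is equivariant by the
    module-algebra axiom and is the multiplication m.

    The brace identity is then a statement on multilinear functions,
    [graft_graft]. Its two sides obey the same recursion on the number of
    arguments of the outer function. In x{x_1, ..., x_m}{y_1, ..., y_n} the first
    argument of x is either an argument of the composite, or a value of y_1, or
    a value of x_1 with y_1, ..., y_k inserted, that is of x_1{y_1, ..., y_k};
    a weave starts with y_1 or x_1{y_1, ..., y_k} accordingly
    ([weave_sum_cons]).

    Finally m{m} = 0 by associativity of A, and in the differential of f the inner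
    faces make up f{m}, up to sign, and the two outer ones m{f} ([hopf_diff]). *)

(** * Equivariant multilinear functions *)

Section Multilinear.
Variables (K : fieldType) (H : bialgType K) (A : modAlgType H).
Implicit Types (W : lmodType K) (s r : seq A) (b : H).

(** Functions of n arguments are functions on lists, looked at on lists of length
    n only. Concatenation of argument lists then needs no casts. *)
Fixpoint multilinear W n (F : seq A -> W) : Prop :=
  if n is m.+1 then
    (forall s, size s = m -> is_linear (fun a => F (a :: s))) /\
    (forall a, multilinear m (fun s => F (a :: s)))
  else True.

(** The sum of F(b_(1) a_1, ..., b_(n) a_n). For n = 0 the empty tensor power is
    the trivial module K, on which b acts by its counit. *)
Fixpoint sweedler_sum W b s (F : seq A -> W) : W :=
  if s is a :: s' then
    tens_lift (fun b1 b2 => sweedler_sum b2 s' (fun r => F (act b1 a :: r))) (comul b)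
  else counit b *: F [::].

Definition equivariant n (F : seq A -> A) : Prop :=
  forall b s, size s = n -> sweedler_sum b s F = act b (F s).

Lemma eq_multilinear W n (F G : seq A -> W) :
  (forall s, size s = n -> F s = G s) -> multilinear n F -> multilinear n G.
Proof.
elim: n F G => [|n IH] F G e //= [l m]; split=> [s sz k a c|a].
  by rewrite -!e /= ?sz // l.
by apply: IH (m a) => s sz; rewrite e //= sz.
Qed.

Lemma multilinear_comp_linear W W' n (F : seq A -> W) (g : W -> W') :
  is_linear g -> multilinear n F -> multilinear n (fun s => g (F s)).
Proof.
move=> lg; elim: n F => [|n IH] F //= [l m]; split=> [s sz|a]; last exact: IH.
exact: lin_comp lg (l s sz).
Qed.

Lemma multilinear_sum W n (I : finType) (P : pred I) (F : I -> seq A -> W) :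
  (forall i, P i -> multilinear n (F i)) ->
  multilinear n (fun s => \sum_(i | P i) F i s).
Proof.
elim: n F => [|n IH] F //= h; split=> [s sz k a c|a].
  rewrite scaler_sumr -big_split; apply: eq_bigr => i Pi.
  exact: (h i Pi).1.
by apply: IH => i Pi; apply: (h i Pi).2.
Qed.

(** One step of a composite: the first d arguments are consumed by the function
    that fills the first slot. *)
Lemma multilinear_insert W d n (f : seq A -> A) (B : A -> seq A -> W) :
  multilinear d f -> (forall s, size s = n -> is_linear (B^~ s)) ->
  (forall a, multilinear n (B a)) ->
  multilinear (d + n) (fun s => B (f (take d s)) (drop d s)).
Proof.
move=> mf lB mB; elim: d f mf => [|d IH] f /= => [_|[lf mf]].
  apply: (eq_multilinear _ (mB (f [::]))) => s _.
  by rewrite take0 drop0.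
split=> [s sz|a]; last exact: (IH (fun s => f (a :: s))).
  apply: (@lin_comp _ _ _ _ (B^~ (drop d s)) (fun a => f (a :: take d s))).
  by apply: lB; rewrite size_drop sz addKn.
by apply: lf; rewrite size_takel // sz leq_addr.
Qed.

Lemma eq_sweedler_sum W b s (F G : seq A -> W) :
  (forall r, size r = size s -> F r = G r) -> sweedler_sum b s F = sweedler_sum b s G.
Proof.
elim: s b F G => [|a s IH] b F G e /=; first by rewrite e.
by apply: eq_lift => b1 b2; apply: IH => r sz; rewrite e //= sz.
Qed.

Lemma sweedler_sum_comp_linear W W' b s (F : seq A -> W) (g : W -> W') :
  is_linear g -> g (sweedler_sum b s F) = sweedler_sum b s (fun r => g (F r)).
Proof.
move=> lg; elim: s b F => [|a s IH] b F /=; first by rewrite linZ.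
by rewrite lift_lin //; apply: eq_lift => b1 b2; rewrite IH.
Qed.

Lemma lin_sweedler_sum (Z : lmodType K) W b s (F : Z -> seq A -> W) :
  (forall r, size r = size s -> is_linear (F^~ r)) ->
  is_linear (fun z => sweedler_sum b s (F z)).
Proof.
elim: s b F => [|a s IH] b F l /=; first by apply: lin_scale; apply: l.
apply: lin_liftl => b1 b2; apply: IH => r sz.
by apply: l; rewrite /= sz.
Qed.

Lemma sweedler_sum_linear W s (F : seq A -> W) :
  multilinear (size s) F -> is_linear (fun b => sweedler_sum b s F).
Proof.
elim: s F => [|a s IH] F /= => [_|[l m]].
  by apply: (lin_counit (F [::]) (g := fun b => b)); apply: lin_id.
apply: lin_liftr; last exact: (lin_comp (@comul_linear _ _) (@lin_id _ _)).
split=> [b2|b1]; last exact: IH.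
apply: lin_sweedler_sum => r sz; apply: (lin_comp (l r sz)); lin.
Qed.

Lemma multilinear_sweedler_sum W n b s (F : seq A -> seq A -> W) :
  (forall r, size r = size s -> multilinear n (F r)) ->
  multilinear n (fun t => sweedler_sum b s (F^~ t)).
Proof.
elim: n F => [|n IH] F //= h; split=> [t sz|a].
  by apply: lin_sweedler_sum => r sr; apply: (h r sr).1.
by apply: (IH (fun r t => F r (a :: t))) => r sr; apply: (h r sr).2.
Qed.

Lemma sweedler_sum_sum W (I : Type) (l : seq I) (P : pred I) b s (F : I -> seq A -> W) :
  sweedler_sum b s (fun r => \sum_(i <- l | P i) F i r) =
  \sum_(i <- l | P i) sweedler_sum b s (F i).
Proof.
elim: s b F => [|a s IH] b F /=; first by rewrite scaler_sumr.
rewrite exchange_big; apply: eq_bigr => p _ /=.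
exact: (IH _ (fun i r => F i (act p.1 a :: r))).
Qed.

Lemma multilinear_cat W m n (F : seq A -> W) s : size s = m ->
  multilinear (m + n) F -> multilinear n (fun r => F (s ++ r)).
Proof.
move=> <-{m}; elim: s F => [|a s IH] F //= [_ m].
exact: (IH (fun r => F (a :: r))).
Qed.

Lemma multilinear_catl W m n (F : seq A -> W) r : size r = n ->
  multilinear (m + n) F -> multilinear m (fun s => F (s ++ r)).
Proof.
move=> sz; elim: m F => [|m IH] F //= [l ml]; split=> [s ss|a].
  by apply: l; rewrite size_cat ss sz.
exact: (IH (fun s => F (a :: s))).
Qed.

(** Coassociativity: the factors of b may be shared out first between two blocks
    of arguments, and then inside each block. *)
Lemma sweedler_sum_cat W b s r (F : seq A -> W) : multilinear (size s + size r) F ->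
  sweedler_sum b (s ++ r) F =
  tens_lift (fun b1 b2 => sweedler_sum b2 r (fun r' =>
    sweedler_sum b1 s (fun s' => F (s' ++ r')))) (comul b).
Proof.
elim: s b F => [|a s IH] b F /= => [m|[l ml]].
  rewrite -(counitl (g := fun b => sweedler_sum b r F)); last first.
    exact: sweedler_sum_linear.
  apply: eq_lift => b1 b2.
  by rewrite (sweedler_sum_comp_linear _ _ _ (g := fun w => _ *: w)) //; lin.
pose T p q c := sweedler_sum c r (fun r' =>
  sweedler_sum q s (fun s' => F (act p a :: s' ++ r'))).
transitivity (tens_lift (fun p b2 => tens_lift (fun q c => T p q c) (comul b2))
  (comul b)).
  by apply: eq_lift => b1 b2; rewrite IH.
rewrite -(coassoc (F := T)).
- apply: eq_lift => b1 b2; rewrite [LHS]/tens_lift -sweedler_sum_sum.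
  by apply: eq_sweedler_sum.
- move=> q c; apply: lin_sweedler_sum => r' sr; apply: lin_sweedler_sum => s' ss.
  apply: (lin_comp (l _ _)); last by lin.
  by rewrite size_cat ss sr.
- move=> p c; apply: lin_sweedler_sum => r' sr.
  apply: (sweedler_sum_linear (F := fun s' => F (act p a :: s' ++ r'))).
  exact: (@multilinear_catl _ _ _ (fun s => F (act p a :: s)) _ sr (ml _)).
- move=> p q; apply: sweedler_sum_linear.
  apply: (@multilinear_sweedler_sum _ _ q s
    (fun s' r' => F (act p a :: s' ++ r'))) => s' ss.
  exact: (@multilinear_cat _ _ _ (fun s => F (act p a :: s)) _ ss (ml _)).
Qed.

End Multilinear.

(** * Cochains as equivariant multilinear functions *)

Section Cochains.
Variables (K : fieldType) (H : bialgType K) (A : modAlgType H).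
Implicit Types (W : lmodType K) (s r : seq A) (b : H).

Lemma tpures_multilinear n : multilinear n.+1 (tpures n : seq A -> tpow A n).
Proof.
elim: n => [|n IH]; first by split.
split=> [s sz|a].
- by move=> k x y; apply: (tpure_bilinear A (tpow A n)).1.
- exact: (multilinear_comp_linear ((tpure_bilinear A (tpow A n)).2 a) IH).
Qed.

Lemma hact_tpures n b s : size s = n.+1 ->
  hact b (tpures n s : tpow A n) = sweedler_sum b s (tpures n : seq A -> tpow A n).
Proof.
elim: n b s => [|n IH] b [|a s] // [sz].
  case: s sz => //= _.
  by rewrite counitr // => k x y; rewrite (@act_bilinear K H A).1.
rewrite [LHS]hact_pure; apply: eq_lift => b1 b2; rewrite IH //.
exact: (sweedler_sum_comp_linear _ _ _ ((tpure_bilinear A (tpow A n)).2 _)).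
Qed.

Lemma tpures_ext n W (f g : tpow A n -> W) : is_linear f -> is_linear g ->
  (forall s, size s = n.+1 -> f (tpures n s) = g (tpures n s)) -> f =1 g.
Proof.
elim: n f g => [|n IH] f g lf lg e t; first exact: (e [:: t]).
move: t; apply: tpow_ext => // c; have tl := (tpure_bilinear A (tpow A n)).2 c.
apply: (IH (fun u => f (tpure c u)) (fun u => g (tpure c u))).
- exact: lin_comp lf tl.
- exact: lin_comp lg tl.
by move=> s sz; apply: (e (c :: s)); rewrite /= sz.
Qed.

Lemma lmult_tpures n a c s :
  lmult a (tpures n (c :: s) : tpow A n) = tpures n (a ** c :: s).
Proof. by case: n => [|n] //; apply: lmult_pure. Qed.

Lemma rmult_tpures n a c s : size s = n ->
  rmult a (tpures n (rcons s c) : tpow A n) = tpures n (rcons s (c ** a)).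
Proof.
elim: n s => [|n IH] [|d s] // [sz].
rewrite -[LHS]/(rmult a (tpure d (tpures n (rcons s c)) : tpow A n.+1)).
by rewrite rmult_pure IH.
Qed.

Lemma cochain_lmult n (f : cochain A n) a t : f (lmult a t) = a ** f t.
Proof.
have [_ /(_ (xpure a aone 1) t)] := cochainP f.
by rewrite !xact_pure !hact1 !rmult1.
Qed.

Lemma cochain_rmult n (f : cochain A n) a t : f (rmult a t) = f t ** a.
Proof.
have [_ /(_ (xpure aone a 1) t)] := cochainP f.
by rewrite !xact_pure !hact1 !lmult1.
Qed.

Lemma cochain_hact n (f : cochain A n) b t : f (hact b t) = act b (f t).
Proof.
have [_ /(_ (xpure aone aone b) t)] := cochainP f.
by rewrite !xact_pure !lmult1 !rmult1.
Qed.

Lemma cochain_tpures n (f : CH_Hopf A n) a s c : size s = n ->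
  cochain_val f (tpures n.+1 (a :: rcons s c)) = a ** ceval f s ** c.
Proof.
move=> sz; rewrite -cochain_lmult -cochain_rmult lmult_tpures amula1.
by rewrite -[a :: rcons s aone]rcons_cons rmult_tpures /= ?sz // amul1a.
Qed.

(** The two outer copies of A inside X allow the outer tensor factors to be
    pulled out of a cochain. *)
Lemma ceval_inj n (f g : CH_Hopf A n) :
  (forall s, size s = n -> ceval f s = ceval g s) -> f = g.
Proof.
move=> e; apply/val_inj/funext; apply: tpures_ext.
- exact: (cochainP f).1.
- exact: (cochainP g).1.
case=> // a s; case/lastP: s => // s c [].
rewrite size_rcons => -[sz]; apply: (etrans (cochain_tpures f a c sz)).
by rewrite e //; apply: esym (cochain_tpures g a c sz).
Qed.

Lemma ceval_linear n s : is_linear (fun f : CH_Hopf A n => ceval f s).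
Proof. by []. Qed.

Lemma multilinear_rcons W n (F : seq A -> W) c :
  multilinear n.+1 F -> multilinear n (fun s => F (rcons s c)).
Proof.
rewrite -addn1 => /(@multilinear_catl _ _ _ _ _ _ _ [:: c] erefl).
by apply: eq_multilinear => s _; rewrite cats1.
Qed.

(** As b acts on 1 by the counit, a slot that holds 1 absorbs its factor of the
    coproduct. *)
Lemma sweedler_sum_unitl W b s (F : seq A -> W) : multilinear (size s).+1 F ->
  sweedler_sum b (aone :: s) F = sweedler_sum b s (fun r => F (aone :: r)).
Proof.
move=> [l m] /=; rewrite -[RHS](counitl (g := fun b => sweedler_sum b s _)); last first.
  exact: sweedler_sum_linear (m _).
apply: eq_lift => b1 b2.
rewrite (sweedler_sum_comp_linear _ _ _ (g := fun w => _ *: w)); last by lin.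
by apply: eq_sweedler_sum => r sz; rewrite act_unit (linZ _ _ (l r sz)).
Qed.

Lemma sweedler_sum_unitr W b s (F : seq A -> W) : multilinear (size s).+1 F ->
  sweedler_sum b (rcons s aone) F = sweedler_sum b s (fun r => F (rcons r aone)).
Proof.
elim: s b F => [|a s IH] b F; first exact: sweedler_sum_unitl.
by move=> [l m] /=; apply: eq_lift => b1 b2; rewrite IH //; apply: m.
Qed.

Lemma cevalZ n k (f : CH_Hopf A n) s : ceval (k *: f) s = k *: ceval f s.
Proof. by []. Qed.

Lemma ceval_slots n (f : CH_Hopf A n) :
  multilinear n.+2 (fun s => cochain_val f (tpures n.+1 s)).
Proof. exact: multilinear_comp_linear (cochainP f).1 (tpures_multilinear _). Qed.

Lemma ceval_multilinear n (f : CH_Hopf A n) : multilinear n (ceval f).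
Proof. exact: multilinear_rcons aone (((ceval_slots f).2) aone). Qed.

(** The element 1 (x) 1 (x) b of X sends 1 (x) a_1 (x) ... (x) a_n (x) 1 to a sum
    over the (n+2)-fold coproduct of b, whose outer factors the two units
    absorb. *)
Lemma ceval_equivariant n (f : CH_Hopf A n) : equivariant n (ceval f).
Proof.
move=> b s sz; rewrite /ceval -cochain_hact hact_tpures; last first.
  by rewrite /= size_rcons sz.
have m := ceval_slots f; rewrite (sweedler_sum_comp_linear _ _ _ (cochainP f).1).
rewrite sweedler_sum_unitl ?size_rcons ?sz //.
rewrite (@sweedler_sum_unitr _ _ _
  (fun r => cochain_val f (tpures n.+1 (aone :: r)))) //.
by rewrite sz; apply: m.2.
Qed.

Fixpoint tpow_lift W n (F : seq A -> W) : tpow A n -> W :=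
  match n with
  | 0 => fun t => F [:: t]
  | m.+1 => fun t => tens_lift (fun a u => tpow_lift (fun s => F (a :: s)) u) t
  end.

Lemma tpow_lift_lin_fun (Z : lmodType K) W n (F : Z -> seq A -> W) (t : tpow A n) :
  (forall s, size s = n.+1 -> is_linear (F^~ s)) ->
  is_linear (fun z => tpow_lift (F z) t).
Proof.
elim: n F t => [|n IH] F t l; first exact: l.
by apply: lin_liftl => a u; apply: IH => s sz; apply: l; rewrite /= sz.
Qed.

Lemma tpow_lift_bilinear W n (F : seq A -> W) : multilinear n.+2 F ->
  (forall a, is_linear (fun u : tpow A n => tpow_lift (fun s => F (a :: s)) u)) ->
  is_bilinear (fun a (u : tpow A n) => tpow_lift (fun s => F (a :: s)) u).
Proof.
by move=> [l m] h; split=> [u|a]; [apply: tpow_lift_lin_fun => s sz; apply: l|apply: h].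
Qed.

Lemma tpow_lift_linear W n (F : seq A -> W) :
  multilinear n.+1 F -> is_linear (fun t : tpow A n => tpow_lift F t).
Proof.
elim: n F => [|n IH] F m; first exact: m.1 [::] erefl.
apply: tens_lift_linear; apply: tpow_lift_bilinear => // a.
by apply: IH; apply: m.2.
Qed.

Lemma tpow_lift_tpures W n (F : seq A -> W) s : multilinear n.+1 F ->
  size s = n.+1 -> tpow_lift F (tpures n s : tpow A n) = F s.
Proof.
elim: n F s => [|n IH] F [|a s] // m [sz]; first by case: s sz.
rewrite [LHS]tens_liftE; first exact: (IH (fun s => F (a :: s)) s (m.2 a) sz).
by apply: (tpow_lift_bilinear m) => c; apply: (tpow_lift_linear (m.2 c)).
Qed.

(** a_0 F(a_1, ..., a_n) a_(n+1), the only possible X-linear extension of F by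
    [cochain_tpures] *)
Definition bordered n (F : seq A -> A) s : A :=
  head 0 s ** F (take n (behead s)) ** head 0 (drop n (behead s)).

Lemma borderedE n F a s c : size s = n ->
  bordered n F (a :: rcons s c) = a ** F s ** c.
Proof. by move=> <-; rewrite /bordered /= -cats1 take_size_cat ?drop_size_cat. Qed.

Lemma bordered_multilinear n F :
  multilinear n F -> multilinear n.+2 (bordered n F).
Proof.
move=> mF; split=> [s sz|a]; first (rewrite /bordered /=; lin).
rewrite -addn1.
apply: (@multilinear_insert _ _ _ _ n 1 F (fun x r => a ** x ** head 0 r)) => //.
  by move=> r _; lin.
by move=> x; split=> // s _; lin.
Qed.

Lemma sweedler_sum_single W b c (G : seq A -> W) : multilinear 1 G ->
  sweedler_sum b [:: c] G = G [:: act b c].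
Proof.
move=> [l _]; rewrite /= (counitr (g := fun b => G [:: act b c])) //.
by apply: (lin_comp (l [::] erefl)); lin.
Qed.

(** Compatibility of the action with products shares out b between the three
    factors of the bordered product, in the order of the tensor factors. *)
Lemma bordered_sweedler_sum n F b a s c : multilinear n F -> equivariant n F ->
  size s = n ->
  sweedler_sum b (a :: rcons s c) (bordered n F) = act b (a ** F s ** c).
Proof.
move=> mF eF sz; rewrite -amulA act_prod [LHS]/=; apply: eq_lift => b1 b2.
have [_ /(_ (act b1 a)) m] := bordered_multilinear mF.
rewrite -cats1 sweedler_sum_cat ?sz ?addn1 // act_prod [RHS]lift_lin; last by lin.
apply: eq_lift => p q; rewrite amulA.
transitivity (sweedler_sum q [:: c] (fun r => act b1 a ** act p (F s) ** head 0 r)).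
  apply: eq_sweedler_sum => -[|d [|//]] // _.
  rewrite -(eF p s sz).
  rewrite (sweedler_sum_comp_linear _ _ _ (g := fun w => act b1 a ** w ** d));
    last by lin.
  apply: eq_sweedler_sum => r sr; rewrite cats1 borderedE //.
  by rewrite sr.
by rewrite sweedler_sum_single //; split=> // r _ /=; lin.
Qed.

(** Together with [ceval_inj], [ceval_multilinear] and [ceval_equivariant] this
    identifies n-cochains with equivariant n-linear functions. *)
Lemma cochain_exists n F : multilinear n F -> equivariant n F ->
  exists f : CH_Hopf A n, forall s, size s = n -> ceval f s = F s.
Proof.
move=> mF eF; have mB := bordered_multilinear mF.
pose f := @tpow_lift A n.+1 (bordered n F).
have lf : is_linear f := tpow_lift_linear mB.
have fE a s c : size s = n -> f (tpures n.+1 (a :: rcons s c)) = a ** F s ** c.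
  by move=> sz; rewrite /f tpow_lift_tpures ?borderedE //= size_rcons sz.
have ext (g h : tpow A n.+1 -> A) : is_linear g -> is_linear h ->
    (forall a s c, size s = n -> g (tpures n.+1 (a :: rcons s c)) =
       h (tpures n.+1 (a :: rcons s c))) -> g =1 h.
  move=> lg lh e; apply: tpures_ext => // -[//|a s].
  case/lastP: s => // s c []; rewrite size_rcons => -[sz]; exact: e.
have fl a t : f (lmult a t) = a ** f t.
  apply: (ext (fun t => f (lmult a t)) (fun t => a ** f t)) => [||d s c sz].
  - exact: lin_comp lf ((lmult_bilinear _ _).2 a).
  - by lin.
  by rewrite lmult_tpures !fE // !amulA.
have fr a t : f (rmult a t) = f t ** a.
  apply: (ext (fun t => f (rmult a t)) (fun t => f t ** a)) => [||d s c sz].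
  - exact: lin_comp lf ((rmult_bilinear _ _).2 a).
  - by lin.
  rewrite -[d :: rcons s c]rcons_cons rmult_tpures /= ?sz //.
  by rewrite !fE // !amulA.
have fh b t : f (hact b t) = act b (f t).
  apply: (ext (fun t => f (hact b t)) (fun t => act b (f t))) => [||d s c sz].
  - exact: lin_comp lf ((hact_bilinear _ _).2 b).
  - by lin.
  rewrite hact_tpures ?(sweedler_sum_comp_linear _ _ _ lf); last first.
    by rewrite /= size_rcons sz.
  rewrite fE // -(bordered_sweedler_sum _ _ _ mF eF sz).
  apply: eq_sweedler_sum => r sr.
  by rewrite /f tpow_lift_tpures //= sr /= size_rcons sz.
have fc : f \in @cochain_pred _ _ A n.
  apply/asboolP; split=> // x t; move: x; apply: cross_ext => [||a a' b].
  - exact: lin_comp lf ((xact_bilinear _ _).1 t).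
  - exact: (xact_bilinear A 0).1.
  by rewrite !xact_pure fl fr fh.
by exists (Cochain fc) => s sz; rewrite /ceval [LHS]fE // amul1a amula1.
Qed.

End Cochains.

(** * Insertion of cochains into multilinear functions *)

Lemma big_tuple_cons (V : nmodType) (T : finType) n (P : pred (seq T))
    (F : seq T -> V) :
  \sum_(t : n.+1.-tuple T | P t) F t =
  \sum_(a : T) \sum_(t : n.-tuple T | P (a :: t)) F (a :: t).
Proof.
rewrite pair_big_dep /= (reindex (fun p : T * n.-tuple T => cons_tuple p.1 p.2)) //.
exists (fun t : n.+1.-tuple T => (thead t, behead_tuple t)) => [[a t]|t] _ /=.
  by congr pair; apply: val_inj.
by rewrite [t in RHS]tuple_eta.
Qed.

Lemma big_tuple0 (V : nmodType) (T : finType) (P : pred (seq T)) (F : seq T -> V) :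
  \sum_(t : 0.-tuple T | P t) F t = if P [::] then F [::] else 0.
Proof.
case: ifP => P0; last by apply: big_pred0 => t; rewrite tuple0.
by apply: (big_pred1 [tuple]) => t; rewrite tuple0 /= P0 eqxx.
Qed.

Lemma big_tuple_cat (V : nmodType) (T : finType) m n (P : pred (seq T))
    (F : seq T -> V) :
  \sum_(t : (m + n).-tuple T | P t) F t =
  \sum_(t1 : m.-tuple T) \sum_(t2 : n.-tuple T | P (t1 ++ t2)) F (t1 ++ t2).
Proof.
elim: m P F => [|m IH] P F.
  by rewrite (big_tuple0 predT
    (fun t1 => \sum_(t2 : n.-tuple T | P (t1 ++ t2)) F (t1 ++ t2))).
rewrite (big_tuple_cons _ P F) (big_tuple_cons _ predT
  (fun t1 => \sum_(t2 : n.-tuple T | P (t1 ++ t2)) F (t1 ++ t2))).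
apply: eq_bigr => a _.
exact: (IH (fun t => P (a :: t)) (fun t => F (a :: t))).
Qed.

(* Simplification would otherwise replace the components of [CH_Hopf A] by their
   construction, and equal degrees would become syntactically different. *)
Arguments cobj : simpl never.
Arguments CH_Hopf : simpl never.

Section Grafting.
Variables (K : fieldType) (H : bialgType K) (A : modAlgType H).
Local Notation helt := (helt (CH_Hopf A)).
Implicit Types (W : lmodType K) (s r : seq A) (b : H) (x y : helt)
  (xs ys zs : seq helt) (e : bitseq).

Definition sgn (i : int) : K := (-1) ^ i.

Lemma sgnD i j : sgn (i + j) = sgn i * sgn j.
Proof. by rewrite /sgn expfzDr // oppr_eq0 oner_eq0. Qed.

Lemma sgn_nat (n : nat) : sgn n%:Z = (-1) ^+ n.
Proof. by []. Qed.

Lemma sgn_opp i : - sgn i = sgn (1 + i).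
Proof. by rewrite sgnD [sgn 1]expr1z mulN1r. Qed.

Lemma sgn_double i j : sgn (i + j + j) = sgn i.
Proof.
by rewrite !sgnD -mulrA -expfzMl mulrNN mulr1 exp1rz mulr1.
Qed.

(** The signed sum [compose], for an arbitrary n-ary function G in place of a
    cochain: fixing the first argument of a cochain no longer gives a cochain,
    and the inductions below do just that. *)
Definition graft W n (G : seq A -> W) xs s : W :=
  \sum_(e : n.-tuple bool | count id e == size xs)
    sgn (plug_sign e xs) *: G (plug e xs s).

Lemma size_plug e xs s : (count id e <= size xs)%N -> size (plug e xs s) = size e.
Proof.
elim: e xs s => [|[] e IH] [|x xs] s //= h; rewrite IH //.
Qed.

Lemma eq_graft W n (G G' : seq A -> W) xs s :
  (forall r, size r = n -> G r = G' r) -> graft n G xs s = graft n G' xs s.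
Proof.
move=> h; apply: eq_bigr => e /eqP c.
by rewrite h // size_plug ?size_tuple // c.
Qed.

Lemma graft0 W (G : seq A -> W) xs s :
  graft 0 G xs s = if xs is [::] then G [::] else 0.
Proof.
rewrite /graft (big_tuple0 (fun e => count id e == size xs)
  (fun e => sgn (plug_sign e xs) *: G (plug e xs s))).
by case: xs => //=; rewrite /sgn expr0z scale1r.
Qed.

(** The first argument of G is either the first argument of the composite or a
    value of x_1. In the second case it is followed by n further slots, whence
    the sign. *)
Lemma graftS W n (G : seq A -> W) xs s :
  graft n.+1 G xs s =
  graft n (fun r => G (head 0 s :: r)) xs (behead s) +
  (if xs is x :: xs' then sgn (sdeg x * n%:Z) *:
     graft n (fun r => G (ceval (tagged x) (take (deg x) s) :: r)) xs'
       (drop (deg x) s) else 0).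
Proof.
rewrite /graft (big_tuple_cons _ (fun e => count id e == size xs)
  (fun e => sgn (plug_sign e xs) *: G (plug e xs s))) big_bool addrC; congr +%R.
case: xs => [|x xs]; first by rewrite big1 // => e; rewrite /= add1n.
rewrite scaler_sumr; apply: eq_big => [e|e _]; first by rewrite /= add1n eqSS.
by rewrite /= size_tuple sgnD scalerA.
Qed.

Lemma graft_gt W n (G : seq A -> W) xs s : (n < size xs)%N -> graft n G xs s = 0.
Proof.
move=> lt; apply: big_pred0 => e; apply/eqP => c.
by have := count_size id e; rewrite size_tuple c leqNgt lt.
Qed.

Lemma graft_nil W n (G : seq A -> W) s : size s = n -> graft n G [::] s = G s.
Proof.
elim: n G s => [|n IH] G [|a s] //; first by rewrite graft0.
by case=> sz; rewrite graftS addr0 IH.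
Qed.

Lemma lin_graft (Z : lmodType K) W n (F : Z -> seq A -> W) xs s :
  (forall r, size r = n -> is_linear (F^~ r)) ->
  is_linear (fun z => graft n (F z) xs s).
Proof.
move=> l k z z'; rewrite /graft scaler_sumr -big_split; apply: eq_bigr => e /eqP c.
rewrite l ?size_plug ?size_tuple ?c //.
by rewrite scalerDr !scalerA mulrC.
Qed.

Lemma graft_comp_linear W W' n (F : seq A -> W) xs s (g : W -> W') : is_linear g ->
  g (graft n F xs s) = graft n (fun r => g (F r)) xs s.
Proof.
by move=> lg; rewrite lin_sum //; apply: eq_bigr => e _; rewrite linZ.
Qed.

Lemma plug_pad e xs s u : count id e = size xs ->
  (size e + \sum_(x <- xs) deg x <= size s + size xs)%N ->
  plug e xs (s ++ u) = plug e xs s.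
Proof.
elim: e xs s => [|[] e IH] [|x xs] s //=.
- rewrite big_cons => -[/[!add0n] c] sz.
  have dx : (deg x <= size s)%N by have := count_size id e; rewrite c; lia.
  rewrite takel_cat // (_ : drop _ (s ++ u) = drop (deg x) s ++ u); last first.
    rewrite -{1}(cat_take_drop (deg x) s) -catA drop_size_cat //.
    by rewrite size_takel.
  by rewrite IH // size_drop; lia.
- by rewrite !big_nil => /[!add0n] c; case: s => [|a s] sz; rewrite /= ?IH ?big_nil.
- case: s => [|a s] /[!add0n] c sz; last by rewrite /= IH.
  by have := count_size id e; rewrite c; lia.
Qed.

(** Surplus arguments are never read, so that argument lists can be padded and
    inductions need only a lower bound on their length. *)
Lemma graft_pad W n (G : seq A -> W) xs s u :
  (n + \sum_(x <- xs) deg x <= size s + size xs)%N ->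
  graft n G xs (s ++ u) = graft n G xs s.
Proof.
by move=> sz; apply: eq_bigr => e /eqP c; rewrite plug_pad ?size_tuple.
Qed.

Lemma plug_multilinear W e xs N (G : seq A -> W) : count id e = size xs ->
  (N + size xs)%N = (size e + \sum_(x <- xs) deg x)%N ->
  multilinear (size e) G -> multilinear N (fun s => G (plug e xs s)).
Proof.
elim: e xs N G => [|[] e IH] [|x xs] N G //=.
- by rewrite big_nil; case: N.
- rewrite big_cons => -[/[!add0n] c] sz [l m].
  have [n defN] : exists n, N = (deg x + n)%N.
    exists (N - deg x)%N.
    have := count_size id e; rewrite c; lia.
  rewrite defN in sz *.
  apply: (@multilinear_insert _ _ _ _ _ _ _ (fun a s => G (a :: plug e xs s))
    (ceval_multilinear (tagged x))) => [s ss|a].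
    by apply: (l (plug e xs s)); rewrite size_plug // c.
  by apply: (IH xs n (fun r => G (a :: r))) => //=; lia.
- move=> /[!add0n] c; rewrite big_nil => sz [l m]; case: N sz => [|N] sz; first by lia.
  split=> [s ss|a].
    by apply: (l (plug e [::] s)); rewrite size_plug ?c.
  by apply: (IH [::] N (fun r => G (a :: r))); rewrite ?big_nil //=; lia.
- move=> /[!add0n] c sz [l m]; have := count_size id e; rewrite c => cs.
  case: N sz => [|N] sz; first by lia.
  split=> [s ss|a].
    by apply: (l (plug e (x :: xs) s)); rewrite size_plug ?c.
  by apply: (IH (x :: xs) N (fun r => G (a :: r))) => //=; lia.
Qed.

Lemma graft_multilinear W n (G : seq A -> W) xs N :
  (N + size xs)%N = (n + \sum_(x <- xs) deg x)%N ->
  multilinear n G -> multilinear N (graft n G xs).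
Proof.
move=> sz mG; apply: multilinear_sum => e /eqP c.
apply: multilinear_comp_linear; first by lin.
by apply: plug_multilinear; rewrite ?size_tuple.
Qed.

(** The factor of b that acts on a slot filled by x_1 is moved into x_1, by
    equivariance, and there spreads over the arguments of x_1. *)
Lemma plug_sweedler_sum W e xs s b (G : seq A -> W) : count id e = size xs ->
  (size s + size xs)%N = (size e + \sum_(x <- xs) deg x)%N ->
  multilinear (size e) G ->
  sweedler_sum b (plug e xs s) G = sweedler_sum b s (fun r => G (plug e xs r)).
Proof.
elim: e xs s b G => [|[] e IH] xs s b G.
- by case: xs => //= _; rewrite big_nil; case: s.
- case: xs => [|x xs] //= [/[!add0n] c]; rewrite big_cons => sz [l m].
  have dx : (deg x <= size s)%N.
    by have := count_size id e; rewrite c; lia.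
  have sd : (size (drop (deg x) s) + size xs =
      size e + \sum_(y <- xs) deg y)%N by rewrite size_drop; lia.
  rewrite -{3}(cat_take_drop (deg x) s) sweedler_sum_cat; last first.
    rewrite -size_cat cat_take_drop.
    apply: (@plug_multilinear _ (true :: e) (x :: xs)) => //=.
    - by rewrite c.
    - by rewrite big_cons.
  apply: eq_lift => b1 b2; rewrite IH //.
  apply: eq_sweedler_sum => r sr; rewrite -(ceval_equivariant (tagged x)); last first.
    by rewrite size_takel.
  rewrite (sweedler_sum_comp_linear _ _ _ (g := fun a => G (a :: plug e xs r)));
    last first.
    by apply: (l (plug e xs r)); rewrite size_plug // c.
  apply: eq_sweedler_sum => t st; rewrite take_size_cat ?drop_size_cat //.
    by rewrite st size_takel.
  by rewrite st size_takel.
- rewrite [count _ _]/= add0n => c sz [l m].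
  have := count_size id e; rewrite c => cs.
  case: s sz => [|a s] sz; first by move: sz => /=; lia.
  move: sz => /= sz; rewrite !addSn in sz; case: sz => sz.
  rewrite /=; apply: eq_lift => b1 b2.
  by apply: (IH xs s b2 (fun r => G (act b1 a :: r))) => //; apply: m.
Qed.

Lemma graft_equivariant n (G : seq A -> A) xs N :
  (N + size xs)%N = (n + \sum_(x <- xs) deg x)%N ->
  multilinear n G -> equivariant n G -> equivariant N (graft n G xs).
Proof.
move=> sz mG eG b s ss.
have la : is_linear (act b : A -> A) by lin.
rewrite /graft (lin_sum _ _ _ la).
rewrite [LHS]sweedler_sum_sum; apply: eq_bigr => e /eqP c.
rewrite linZ // -eG ?size_plug ?size_tuple ?c //.
rewrite plug_sweedler_sum ?size_tuple ?ss //.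
by rewrite (sweedler_sum_comp_linear _ _ _ (g := fun w => _ *: w)) //; lin.
Qed.

End Grafting.

(** * Recursion for the sum over weaves *)

Section MonotoneSums.
Variable V : nmodType.
Implicit Types (F G : seq nat -> V) (l : seq nat).

(** Iterated form of the sum over nondecreasing sequences with entries between lo
    and n. Unlike tuples of ordinals it allows the first entries to be fixed and
    the bounds to be shifted. *)
Fixpoint monotone_sum k lo n F : V :=
  if k is k'.+1 then
    \sum_(lo <= i < n.+1) monotone_sum k' i n (fun l => F (i :: l))
  else F [::].

Lemma monotone_sumE k lo n F :
  \sum_(t : k.-tuple 'I_n.+1 | path leq lo (map val t)) F (map val t) =
  monotone_sum k lo n F.
Proof.
elim: k lo F => [|k IH] lo F.
  exact: (big_tuple0 (fun t => path leq lo (map val t)) (fun t => F (map val t))).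
rewrite (big_tuple_cons _ (fun t => path leq lo (map val t))
  (fun t => F (map val t))) /= big_geq_mkord [RHS]big_mkcond.
apply: eq_bigr => i _; case: ifP => /= le; last by apply: big_pred0 => t; rewrite le.
by rewrite -(IH i (fun l => F (val i :: l))); apply: eq_bigl => t; rewrite le.
Qed.

Lemma eq_monotone_sum k lo n F G : (forall l, size l = k -> F l = G l) ->
  monotone_sum k lo n F = monotone_sum k lo n G.
Proof.
elim: k lo F G => [|k IH] lo F G e /=; first exact: e.
by apply: eq_bigr => i _; apply: IH => l sl; apply: e; rewrite /= sl.
Qed.

Lemma monotone_sum_shift c k lo n F :
  monotone_sum k (c + lo) (c + n) F = monotone_sum k lo n (fun l => F (map (addn c) l)).
Proof.
elim: k lo F => [|k IH] lo F //=.
rewrite addnC big_addn subSn ?leq_addr // addKn.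
by apply: eq_bigr => i _; rewrite addnC IH.
Qed.

End MonotoneSums.

Lemma monotone_sum_scale (K : fieldType) (W : lmodType K) c k lo n (F : seq nat -> W) :
  c *: monotone_sum k lo n F = monotone_sum k lo n (fun l => c *: F l).
Proof.
elim: k lo F => [|k IH] lo F //=.
by rewrite scaler_sumr; apply: eq_bigr => i _; rewrite IH.
Qed.

Section Weaving.
Variables (K : fieldType) (V : nat -> lmodType K) (br : brace_op V).
Variable W : lmodType K.
Local Notation helt := (helt V).
Implicit Types (x y : helt) (xs ys zs : seq helt) (P : seq helt -> W)
  (l : seq nat).

Definition tdeg xs : int := \sum_(x <- xs) sdeg x.

Lemma tdeg_nil : tdeg [::] = 0.
Proof. exact: big_nil. Qed.

Lemma tdeg_cons x xs : tdeg (x :: xs) = sdeg x + tdeg xs.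
Proof. exact: big_cons. Qed.

Lemma tdeg_cat xs ys : tdeg (xs ++ ys) = tdeg xs + tdeg ys.
Proof. exact: big_cat. Qed.

Lemma tdegE xs : tdeg xs = (\sum_(x <- xs) deg x)%N%:Z - (size xs)%:Z.
Proof.
elim: xs => [|x xs IH]; first by rewrite /tdeg !big_nil.
by rewrite tdeg_cons IH big_cons /sdeg /=; lia.
Qed.

Lemma weave_shift c pos xs ys l :
  weave br (c + pos) xs ys (map (addn c) l) = weave br pos xs (drop c ys) l.
Proof.
elim: xs pos l => [|x xs IH] pos [|i [|j l]] /=; rewrite ?drop_drop 1?addnC //.
by rewrite IH !take_drop !drop_drop ![(_ + c)%N]addnC.
Qed.

Lemma brace_sign_cons x xs ys i j l :
  brace_sign (x :: xs) ys [:: i, j & l] =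
  sdeg x * tdeg (take i ys) + brace_sign xs ys l.
Proof. by rewrite /brace_sign /= big_ord_recl. Qed.

Lemma brace_sign_shift c xs ys l : size l = (size xs).*2 ->
  brace_sign xs ys (map (addn c) l) =
  tdeg (take c ys) * tdeg xs + brace_sign xs (drop c ys) l.
Proof.
elim: xs l => [|x xs IH] [|i [|j l]] //=.
  by move=> _; rewrite /brace_sign /tdeg !big_ord0 big_nil mulr0.
move=> [sl]; rewrite !brace_sign_cons IH // takeD tdeg_cat tdeg_cons; ring.
Qed.

(** The right-hand side of the brace identity, with P in place of x{-} *)
Definition weave_sum xs ys P : W :=
  \sum_(t : (size xs).*2.-tuple 'I_(size ys).+1 | sorted leq (map val t))
    (-1) ^ brace_sign xs ys (map val t) *: P (weave br 0 xs ys (map val t)).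

Lemma weave_sumE xs ys P : weave_sum xs ys P =
  monotone_sum (size xs).*2 0 (size ys)
    (fun l => sgn K (brace_sign xs ys l) *: P (weave br 0 xs ys l)).
Proof.
rewrite -monotone_sumE; apply: eq_bigl => t.
by case: (map val t) => //= i l.
Qed.

Lemma size_weave pos xs ys l : size l = (size xs).*2 ->
  (size xs <= size (weave br pos xs ys l))%N.
Proof.
elim: xs pos l => [|x xs IH] pos [|i [|j l]] //= [sl].
by rewrite size_cat /= addnS ltnS (leq_trans (IH j l sl)) // leq_addl.
Qed.

Lemma eq_weave_sum xs ys P P' :
  (forall zs, (size xs <= size zs)%N -> P zs = P' zs) ->
  weave_sum xs ys P = weave_sum xs ys P'.
Proof.
move=> e; apply: eq_bigr => t _; rewrite e //.
by apply: size_weave; rewrite size_map size_tuple.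
Qed.

Lemma weave_sum0 xs ys P :
  (forall zs, (size xs <= size zs)%N -> P zs = 0) -> weave_sum xs ys P = 0.
Proof.
move=> e; rewrite (@eq_weave_sum _ _ _ (fun=> 0)) //.
by apply: big1 => t _; rewrite scaler0.
Qed.

Lemma weave_sumD xs ys P P' :
  weave_sum xs ys (fun zs => P zs + P' zs) = weave_sum xs ys P + weave_sum xs ys P'.
Proof. by rewrite -big_split; apply: eq_bigr => t _; rewrite scalerDr. Qed.

Lemma weave_sumZ xs ys c P :
  weave_sum xs ys (fun zs => c *: P zs) = c *: weave_sum xs ys P.
Proof.
by rewrite scaler_sumr; apply: eq_bigr => t _; rewrite !scalerA mulrC.
Qed.

Lemma weave_sum_nil ys P : weave_sum [::] ys P = P ys.
Proof.
by rewrite weave_sumE /= drop0 /brace_sign big_ord0 /sgn expr0z scale1r.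
Qed.

(** If i_1 = 0, a weave starts with x_1{y_1, ..., y_k} where k = j_1; otherwise it
    starts with y_1, and all indices decrease by one once y_1 is removed. The
    signs come from the entries of ys that have left the front: they precede
    every remaining entry of xs. *)
Lemma weave_sum_cons x xs ys P :
  weave_sum (x :: xs) ys P =
  \sum_(0 <= k < (size ys).+1) sgn K (tdeg (take k ys) * tdeg xs) *:
    weave_sum xs (drop k ys) (fun zs => P (hbrace br x (take k ys) :: zs)) +
  (if ys is y :: ys' then sgn K (sdeg y * tdeg (x :: xs)) *:
     weave_sum (x :: xs) ys' (fun zs => P (y :: zs)) else 0).
Proof.
rewrite weave_sumE /= big_ltn //; congr (_ + _).
  apply: eq_big_nat => k /andP[_ kn].
  rewrite weave_sumE size_drop.
  have := monotone_sum_shift k (size xs).*2 0 (size ys - k)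
    (fun l => sgn K (brace_sign (x :: xs) ys [:: 0%N, k & l]) *:
      P (weave br 0 (x :: xs) ys [:: 0%N, k & l])).
  rewrite addn0 subnKC // => ->; rewrite monotone_sum_scale.
  apply: eq_monotone_sum => l sl.
  rewrite brace_sign_cons brace_sign_shift // take0 tdeg_nil mulr0 add0r sgnD.
  by rewrite -scalerA /= -[X in weave _ X](addn0 k) weave_shift !drop0 take0.
case: ys => [|y ys]; first by rewrite big_geq.
rewrite -weave_sumZ weave_sumE.
have := monotone_sum_shift 1 (size xs).*2.+2 0 (size ys)
    (fun l => sgn K (brace_sign (x :: xs) (y :: ys) l) *:
      P (weave br 0 (x :: xs) (y :: ys) l)).
rewrite [LHS]/= => ->; apply: eq_monotone_sum => -[|i [|j l]] // sl.
rewrite brace_sign_shift // [take 1 _]/= take0 tdeg_cons tdeg_nil addr0 sgnD.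
rewrite [sgn _ _ * _]mulrC -scalerA; congr (_ *: (_ *: P _)); last first.
  by rewrite /= drop0 (weave_shift 1 j) /= drop0.
by rewrite drop1.
Qed.

End Weaving.

(** * The brace identity for multilinear functions *)

Section Core.
Variables (K : fieldType) (H : bialgType K) (A : modAlgType H).
Local Notation helt := (helt (CH_Hopf A)).
Implicit Types (W : lmodType K) (s r : seq A) (b : H) (x y : helt)
  (xs ys zs : seq helt) (e : bitseq).

Definition consumed e xs := (count negb e + \sum_(x <- xs) deg x)%N.

Lemma plug_cat e1 e2 ys s : (count id e1 <= size ys)%N ->
  plug (e1 ++ e2) ys s =
  plug e1 (take (count id e1) ys) s ++
  plug e2 (drop (count id e1) ys) (drop (consumed e1 (take (count id e1) ys)) s).
Proof.
rewrite /consumed; elim: e1 ys s => [|[] e IH] [|y ys] s //=.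
- by rewrite big_nil drop0.
- by rewrite big_nil drop0.
- rewrite add1n ltnS => h; rewrite IH // drop_drop /= big_cons.
  by congr (_ :: _ ++ plug _ _ (drop _ _)); rewrite !add0n; lia.
- rewrite add0n => h; rewrite IH // -[behead s]drop1 drop_drop /=.
  by congr (_ :: _ ++ plug _ _ (drop _ _)); lia.
- rewrite add0n => h; rewrite (IH (y :: ys)) // -[behead s]drop1 drop_drop.
  by congr (_ :: _ ++ plug _ _ (drop _ _)); lia.
Qed.

Lemma plug_sign_cat e1 e2 ys : (count id e1 <= size ys)%N ->
  plug_sign (e1 ++ e2) ys =
  plug_sign e1 (take (count id e1) ys) +
  tdeg (take (count id e1) ys) * (size e2)%:Z +
  plug_sign e2 (drop (count id e1) ys).
Proof.
elim: e1 ys => [|[] e IH] [|y ys] //=.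
- by rewrite tdeg_nil mul0r !add0r.
- by rewrite tdeg_nil mul0r !add0r.
- rewrite add1n ltnS => h; rewrite IH //= size_cat tdeg_cons PoszD; ring.
- by rewrite add0n => h; rewrite IH.
- by rewrite add0n => h; rewrite (IH (y :: ys)).
Qed.

(** Cuts the d + n slots after the first d, of which k are filled. Each of
    y_1, ..., y_k is followed by the n slots of the second part, whence the
    sign. *)
Lemma graft_split W d n (F : seq A -> seq A -> W) ys s :
  graft (d + n) (fun r => F (take d r) (drop d r)) ys s =
  \sum_(0 <= k < (size ys).+1) sgn K (tdeg (take k ys) * n%:Z) *:
    graft d (fun r1 => graft n (F r1) (drop k ys)
      (drop (d - k + \sum_(y <- take k ys) deg y) s)) (take k ys) s.
Proof.
pose term e1 e2 k := sgn K (plug_sign e1 (take k ys) + tdeg (take k ys) * n%:Z +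
  plug_sign e2 (drop k ys)) *: F (plug e1 (take k ys) s)
    (plug e2 (drop k ys) (drop (d - k + \sum_(y <- take k ys) deg y) s)).
transitivity (\sum_(e1 : d.-tuple bool) \sum_(e2 : n.-tuple bool |
    (count id e1 + count id e2 == size ys)%N) term e1 e2 (count id e1)).
  rewrite /graft (big_tuple_cat _ _ (fun e => count id e == size ys) (fun e =>
    sgn K (plug_sign e ys) *: F (take d (plug e ys s)) (drop d (plug e ys s)))).
  apply: eq_bigr => e1 _; apply: eq_big => e2; first by rewrite count_cat.
  rewrite count_cat => /eqP c.
  have le : (count id e1 <= size ys)%N by rewrite -c leq_addr.
  have sp := size_plug (e := e1) (xs := take (count id e1) ys) s.
  rewrite size_tuple size_takel // leqnn in sp; have {}sp := sp isT.
  rewrite plug_cat // plug_sign_cat // size_tuple /consumed.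
  rewrite take_size_cat ?drop_size_cat // /term.
  have <- // : (d - count id e1 = count negb e1)%N.
  by rewrite -[in X in (X - _)%N](size_tuple e1) -(count_predC id e1) addKn.
transitivity (\sum_(k < (size ys).+1) \sum_(e1 : d.-tuple bool | count id e1 == k)
    \sum_(e2 : n.-tuple bool | (count id e1 + count id e2 == size ys)%N) term e1 e2 k).
  rewrite [RHS](exchange_big_dep predT) //=; apply: eq_bigr => e1 _.
  have [le|gt] := leqP (count id e1) (size ys); last first.
    rewrite big_pred0 => [|e2]; last by apply/eqP; lia.
    by rewrite big_pred0 // => k; apply/eqP; have := ltn_ord k; lia.
  rewrite (big_pred1 (inord (count id e1))) ?inordK // => k.
  by rewrite /= -[k == _]val_eqE /= inordK // eq_sym.
rewrite big_mkord; apply: eq_bigr => -[k /= kn] _.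
rewrite scaler_sumr /graft size_takel //; apply: eq_bigr => e1 /eqP c1.
rewrite !scaler_sumr size_drop; apply: eq_big => e2; first by rewrite c1; lia.
by move=> _; rewrite /term !sgnD !scalerA; congr (_ *: _); ring.
Qed.

(* The values of a brace are all that the identity depends on. *)
Variable br : brace_op (CH_Hopf A).
Hypothesis brE : forall x xs s,
  size s = deg (hbrace br x xs) ->
  ceval (tagged (hbrace br x xs)) s = graft (deg x) (ceval (tagged x)) xs s.

(** Induction on the number of slots of G, by what the first slot holds: an
    argument of the composite, a value of y_1, or a value of x_1. In the last case
    [graft_split] separates the arguments of x_1 from the others and turns it
    into a value of x_1{y_1, ..., y_k}. The signs agree since the composite
    G{xs} has D = n + sum |x_p| arguments. *)
Lemma graft_graft W n (G : seq A -> W) D xs ys s : multilinear n G ->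
  (D + size xs)%N = (n + \sum_(x <- xs) deg x)%N ->
  (D + \sum_(y <- ys) deg y <= size s)%N ->
  graft D (graft n G xs) ys s =
  weave_sum br xs ys (fun zs => graft n G zs s).
Proof.
elim: n D G xs ys s => [|n IH] D G xs ys s mG defD sz.
  case: xs defD => [|x xs] defD.
    have -> : D = 0%N by move: defD; rewrite big_nil /=; lia.
    rewrite weave_sum_nil.
    by apply: eq_graft => -[|//] _; rewrite graft0.
  rewrite weave_sum0; last by case=> // z zs _; rewrite graft0.
  apply: big1 => e _; rewrite graft0 scaler0 //.
case: xs defD => [|x xs] defD.
  have -> : D = n.+1 by move: defD; rewrite big_nil /=; lia.
  rewrite weave_sum_nil.
  by apply: eq_graft => r sr; rewrite graft_nil.
have [lG mG'] := mG.
rewrite big_cons /= in defD.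
(* the two summands of [graftS] for the right-hand side *)
pose first_plain zs := graft n (fun r => G (head 0 s :: r)) zs (behead s).
pose first_filled zs := if zs is z :: zs' then sgn K (sdeg z * n%:Z) *:
     graft n (fun r => G (ceval (tagged z) (take (deg z) s) :: r)) zs'
       (drop (deg z) s) else 0.
rewrite (@eq_weave_sum _ _ _ _ _ _ _ (fun zs => first_plain zs + first_filled zs));
  last by move=> zs _; rewrite graftS.
rewrite weave_sumD [X in _ + X]weave_sum_cons.
have -> : graft D (graft n.+1 G (x :: xs)) ys s =
  graft D (fun r =>
     graft n (fun t => G (head 0 r :: t)) (x :: xs) (behead r)) ys s +
  sgn K (sdeg x * n%:Z) *: graft D (fun r =>
     graft n (fun t => G (ceval (tagged x) (take (deg x) r) :: t)) xs
       (drop (deg x) r)) ys s.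
  rewrite scaler_sumr -big_split; apply: eq_bigr => e _ /=.
  by rewrite graftS scalerDr !scalerA [sgn K (sdeg x * _) * _]mulrC.
rewrite [X in _ = _ + X]addrC addrA; congr (_ + _).
  (* D = 0 forces more entries in x :: xs than the n slots that remain. *)
  case: D defD sz => [|D] defD sz.
    have lt : (n < size (x :: xs))%N by rewrite /=; lia.
    rewrite [LHS]big1 => [|e _]; last by rewrite graft_gt ?scaler0.
    rewrite weave_sum0 => [|zs le]; last by rewrite [LHS]graft_gt ?(leq_trans lt).
    case: ys {sz} => [|y ys]; rewrite add0r // weave_sum0 ?scaler0 // => zs le.
    by rewrite /first_filled graft_gt ?scaler0 ?(leq_trans lt).
  have defD0 : (D + size (x :: xs))%N = (n + \sum_(y <- x :: xs) deg y)%N.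
    by rewrite big_cons /=; lia.
  rewrite graftS; congr (_ + _).
    apply: (IH D (fun r => G (head 0 s :: r)) _ _ _ (mG' _)) => //.
    by rewrite size_behead; lia.
  case: ys sz => [|y ys] // sz.
  rewrite big_cons in sz.
  rewrite [weave_sum _ _ ys _]weave_sumZ scalerA -sgnD; congr (sgn K _ *: _).
    by rewrite -mulrDr tdegE big_cons /=; congr (_ * _); lia.
  apply: (IH D (fun r => G (ceval (tagged y) (take (deg y) s) :: r)) _ _ _
    (mG' _)) => //.
  by rewrite size_drop; lia.
have [le|lt] := leqP (size xs) n; last first.
  rewrite [X in _ *: X]big1 => [|e _]; last by rewrite graft_gt ?scaler0.
  rewrite scaler0 big_nat big1 // => k _.
  rewrite weave_sum0 ?scaler0 // => zs lz.
  by rewrite /first_filled graft_gt ?scaler0 ?(leq_trans lt).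
(* c is the number of arguments left after those of x. *)
have [c defc] : exists c, D = (deg x + c)%N by exists (D - deg x)%N; lia.
subst D.
rewrite (@graft_split _ _ _
  (fun r1 r2 => graft n (fun t => G (ceval (tagged x) r1 :: t)) xs r2)).
rewrite scaler_sumr.
apply: eq_big_nat => k /andP[_ kn].
set hb := hbrace br x (take k ys).
have ks : size (take k ys) = k by rewrite size_takel.
have sumE : (\sum_(y <- ys) deg y =
    \sum_(y <- take k ys) deg y + \sum_(y <- drop k ys) deg y)%N.
  by rewrite -big_cat cat_take_drop.
have dhb : deg hb = (deg x + \sum_(y <- take k ys) deg y - k)%N by rewrite -{2}ks.
have dle : (deg hb <= size s)%N by rewrite dhb; lia.
have vhb : ceval (tagged hb) (take (deg hb) s) =
    graft (deg x) (ceval (tagged x)) (take k ys) (take (deg hb) s).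
  by apply: brE; rewrite size_takel.
rewrite [weave_sum _ _ _ _]weave_sumZ.
(* x has too few slots for k insertions, and both sides vanish. *)
have [kd|dk] := leqP k (deg x); last first.
  rewrite graft_gt ?ks // !scaler0 weave_sum0 ?scaler0 // => zs lz.
  rewrite vhb (_ : graft (deg x) _ _ _ = 0); last by rewrite graft_gt ?ks.
  apply: (lin0 (f := fun a => graft n (fun r => G (a :: r)) zs _)).
  by apply: lin_graft.
pose L a := graft c (graft n (fun t => G (a :: t)) xs) (drop k ys) (drop (deg hb) s).
have lL : is_linear L.
  by apply: lin_graft => r _; apply: lin_graft.
have -> : (deg x - k + \sum_(y <- take k ys) deg y)%N = deg hb by rewrite dhb; lia.
rewrite -(graft_comp_linear _ _ _ _ lL).
rewrite -[s in graft (deg x) _ _ s](cat_take_drop (deg hb)).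
rewrite graft_pad ?ks -?vhb; last by rewrite size_takel // dhb; lia.
rewrite /L (IH _ _ _ _ _ (mG' _)) ?size_drop //; [|lia|rewrite dhb; lia].
rewrite !scalerA -!sgnD; congr (sgn K _ *: _).
have -> : sdeg hb = sdeg x + tdeg (take k ys) by rewrite tdegE /sdeg dhb ks; lia.
have -> : c%:Z = n%:Z + tdeg xs by rewrite tdegE; lia.
ring.
Qed.

End Core.

(** * Braces and multiplication on Hopf-Hochschild cochains *)

Lemma lin_add (K : fieldType) (U V : lmodType K) (f g : U -> V) :
  is_linear f -> is_linear g -> is_linear (fun z => f z + g z).
Proof. by move=> lf lg k x y; rewrite lf lg scalerDr addrACA. Qed.

Section HopfBraces.
Variables (K : fieldType) (H : bialgType K) (A : modAlgType H).
Local Notation helt := (helt (CH_Hopf A)).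
Local Notation hom := Defs.hom.
Implicit Types (W : lmodType K) (s r : seq A) (b : H) (x y : helt)
  (xs ys zs : seq helt).

Lemma graft_linear_arg W m (G : seq A -> W) ys n zs s : multilinear m G ->
  is_linear (fun u : CH_Hopf A n => graft m G (ys ++ hom u :: zs) s).
Proof.
elim: m G ys s => [|m IH] G ys s.
  move=> _ k u v; case: ys => [|y ys]; by rewrite !graft0 scaler0 addr0.
move=> [lG mG]; case: ys => [|y ys] k u v; rewrite !graftS.
  apply: (@lin_add _ _ _
    (fun u => graft m (fun r => G (head 0 s :: r)) (hom u :: zs) _)
    (fun u => sgn K _ *:
       graft m (fun r => G (ceval (u : CH_Hopf A n) (take n s) :: r)) zs _)).
    exact: (IH _ [::] _ (mG _)).
  apply: lin_scale; apply: lin_graft => r sr.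
  exact: (lin_comp (lG r sr) (@ceval_linear _ _ A n _)).
apply: (@lin_add _ _ _
  (fun u => graft m (fun r => G (head 0 s :: r)) (y :: ys ++ hom u :: zs) _)
  (fun u => sgn K _ *:
     graft m (fun r => G (ceval (tagged y) _ :: r)) (ys ++ hom u :: zs) _)).
  exact: (IH _ (y :: ys) _ (mG _)).
by apply: lin_scale; apply: (IH _ _ _ (mG _)).
Qed.

Definition balanced x xs N := (N + size xs)%N = (deg x + \sum_(y <- xs) deg y)%N.

Lemma brace_exists x xs N : exists f : CH_Hopf A N,
  (balanced x xs N -> forall s, size s = N ->
     ceval f s = graft (deg x) (ceval (tagged x)) xs s) /\
  (~ balanced x xs N -> f = 0).
Proof.
have [bal|nbal] := pselect (balanced x xs N); last by exists 0; split.
have mx := ceval_multilinear (tagged x).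
have [f fE] := cochain_exists (graft_multilinear bal mx)
  (graft_equivariant bal mx (@ceval_equivariant _ _ _ _ (tagged x))).
by exists f; split.
Qed.

(** By [ceval_inj] only one cochain qualifies, so the choice is immaterial. *)
Definition hopf_brace : brace_op (CH_Hopf A) :=
  fun x xs N => sval (cid (brace_exists x xs N)).

Lemma hopf_braceE x xs N s : balanced x xs N -> size s = N ->
  ceval (hopf_brace x xs N) s = graft (deg x) (ceval (tagged x)) xs s.
Proof. by rewrite /hopf_brace; case: cid => f [/= h _] /h; apply. Qed.

Lemma hopf_brace0 x xs N : ~ balanced x xs N -> hopf_brace x xs N = 0.
Proof. by rewrite /hopf_brace; case: cid => f [/= _ h] /h. Qed.

Lemma hopf_brace_linear_head n xs N :
  is_linear (fun u : CH_Hopf A n => hopf_brace (hom u) xs N).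
Proof.
move=> k u v; have [bal|nbal] := pselect (balanced (hom u) xs N); last first.
  by rewrite !hopf_brace0 // scaler0 addr0.
apply: ceval_inj => s ss; rewrite ceval_linear !hopf_braceE //.
exact: (@lin_graft _ _ _ _ _ _ (fun u r => ceval (u : CH_Hopf A n) r)).
Qed.

Lemma hopf_brace_linear_arg x ys n zs N :
  is_linear (fun u : CH_Hopf A n => hopf_brace x (ys ++ hom u :: zs) N).
Proof.
move=> k u v.
have e (w : CH_Hopf A n) : balanced x (ys ++ hom w :: zs) N <->
    balanced x (ys ++ hom u :: zs) N.
  by rewrite /balanced !size_cat !big_cat !big_cons.
have [bal|nbal] := pselect (balanced x (ys ++ hom u :: zs) N); last first.
  by rewrite !hopf_brace0 ?scaler0 ?addr0 // e.
apply: ceval_inj => s ss; rewrite ceval_linear !hopf_braceE ?e //.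
exact: (graft_linear_arg ys zs s (ceval_multilinear (tagged x)) k u v).
Qed.

Lemma hopf_brace_nil n (u : CH_Hopf A n) : hopf_brace (hom u) [::] n = u.
Proof.
apply: ceval_inj => s ss; rewrite hopf_braceE //.
  by rewrite graft_nil.
by rewrite /balanced big_nil.
Qed.

Lemma hopf_brace_gt x xs N : (deg x < size xs)%N -> hopf_brace x xs N = 0.
Proof.
move=> lt; have [bal|] := pselect (balanced x xs N); last exact: hopf_brace0.
by apply: ceval_inj => s ss; rewrite hopf_braceE // graft_gt.
Qed.

(** If xs is longer than the list of arguments of x, the truncated degree of
    [hbrace] carries the zero cochain, and the sum on the right is empty. *)
Lemma hopf_hbraceE x xs s : size s = deg (hbrace hopf_brace x xs) ->
  ceval (tagged (hbrace hopf_brace x xs)) s =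
  graft (deg x) (ceval (tagged x)) xs s.
Proof.
move=> ss; have [le|lt] := leqP (size xs) (deg x).
  apply: hopf_braceE => //; rewrite /balanced subnK //.
  exact: leq_trans le (leq_addr _ _).
by rewrite graft_gt //= hopf_brace_gt.
Qed.

(** The total degree of a weave is the expected one, except when some x_p receives
    more entries of ys than it has arguments. Truncation of degrees then breaks
    the count, but that entry of the weave is zero. *)
Lemma weave_balanced pos xs ys t : path leq pos t -> size t = (size xs).*2 ->
  let w := weave hopf_brace pos xs ys t in
  (exists zs1 n zs2, w = zs1 ++ hom (0 : CH_Hopf A n) :: zs2) \/
  (\sum_(z <- w) deg z + size xs + size (drop pos ys) =
   size w + \sum_(x <- xs) deg x + \sum_(y <- drop pos ys) deg y)%N.
Proof.
elim: xs pos t => [|x xs IH] pos [|i [|j t]] //=.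
  by move=> _ _; right; rewrite big_nil; lia.
case/and3P=> pi ij pt [st].
have [[zs1 [n [zs2 ->]]]|e] := IH j t pt st.
  left; exists (drop pos (take i ys) ++
    hbrace hopf_brace x (drop i (take j ys)) :: zs1), n, zs2.
  by rewrite -catA.
set mid := drop i (take j ys).
have [bal|nbal] := pselect
  (balanced x mid (deg x + \sum_(y <- mid) deg y - size mid)); last first.
  left; rewrite /hbrace hopf_brace0 //.
  by exists (drop pos (take i ys)), (deg x + \sum_(y <- mid) deg y - size mid)%N,
    (weave hopf_brace j xs ys t).
right; have cut a c : (a <= c)%N -> drop a ys = drop a (take c ys) ++ drop c ys.
  move=> ac; rewrite -{1}(subnK ac) -take_drop -[in drop c ys](subnK ac) -drop_drop.
  by rewrite cat_take_drop.
rewrite (cut _ _ pi) (cut _ _ ij) -/mid !big_cat !big_cons !size_cat /=.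
by move: bal e; rewrite /balanced /deg /=; lia.
Qed.

Lemma hopf_brace_brace x xs ys N :
  hopf_brace (hbrace hopf_brace x xs) ys N =
  \sum_(t : (size xs).*2.-tuple 'I_(size ys).+1 | sorted leq (map val t))
    (-1) ^ brace_sign xs ys (map val t) *:
      hopf_brace x (weave hopf_brace 0%N xs ys (map val t)) N.
Proof.
have [lt|le] := ltnP (deg x) (size xs).
  rewrite [hbrace _ _ _]/hbrace (hopf_brace_gt _ lt).
  rewrite (lin0 (hopf_brace_linear_head _ _)).
  rewrite big1 // => t _; rewrite hopf_brace_gt ?scaler0 //.
  by apply: leq_trans lt _; apply: size_weave; rewrite size_map size_tuple.
set D := (deg x + \sum_(y <- xs) deg y - size xs)%N.
have defD : (D + size xs)%N = (deg x + \sum_(y <- xs) deg y)%N.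
  by rewrite subnK // (leq_trans le) ?leq_addr.
have weaveE l : sorted leq l -> size l = (size xs).*2 ->
    let w := weave hopf_brace 0 xs ys l in
    hopf_brace x w N = 0 /\ (forall s, graft (deg x) (ceval (tagged x)) w s = 0) \/
    (balanced x w N <-> balanced (hbrace hopf_brace x xs) ys N).
  move=> sl zl /=; have pl : path leq 0 l by case: l sl {zl}.
  have [[zs1 [n [zs2 ->]]]|e] := weave_balanced ys pl zl.
    left; rewrite (lin0 (hopf_brace_linear_arg _ _ _ _)); split=> // s.
    exact: lin0 (graft_linear_arg _ _ _ (ceval_multilinear _)).
  right; rewrite drop0 in e; rewrite /balanced [deg (hbrace _ _ _)]/= -/D.
  move: e; move: (weave hopf_brace 0 xs ys l) => w e; split; lia.
have szt (t : (size xs).*2.-tuple 'I_(size ys).+1) : size (map val t) = (size xs).*2.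
  by rewrite size_map size_tuple.
have [bal|nbal] := pselect (balanced (hbrace hopf_brace x xs) ys N); last first.
  rewrite hopf_brace0 // big1 // => t /weaveE/(_ (szt t))[[-> _]|e].
    by rewrite scaler0.
  by rewrite hopf_brace0 ?scaler0 // e.
apply: ceval_inj => s ss; rewrite hopf_braceE //.
rewrite (lin_sum _ _ _ (@ceval_linear _ _ A N s)).
transitivity (weave_sum hopf_brace xs ys
  (fun zs => graft (deg x) (ceval (tagged x)) zs s)); last first.
  apply: eq_bigr => t /weaveE/(_ (szt t)) e; rewrite cevalZ.
  case: e => [[-> ->] //|e].
  by rewrite hopf_braceE // e.
rewrite -/D.
transitivity (graft D (graft (deg x) (ceval (tagged x)) xs) ys s).
  by apply: eq_graft => r sr; apply: hopf_hbraceE.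
(* padding makes room for the lower bound in [graft_graft] *)
have bs : (size s + size ys)%N = (D + \sum_(y <- ys) deg y)%N by rewrite ss.
have mx := ceval_multilinear (tagged x).
rewrite -(graft_pad _ (nseq (size ys) 0)); last by rewrite bs.
rewrite (graft_graft hopf_hbraceE mx defD); last by rewrite size_cat size_nseq bs.
apply: eq_bigr => t /weaveE/(_ (szt t))[[_ z0]|e]; first by rewrite !z0.
rewrite graft_pad //.
by move/e: bal; rewrite /balanced ss => ->.
Qed.

Definition hopf_brace_algebra : braceAlgebra (CH_Hopf A) :=
  BraceAlgebra (@hopf_brace0) hopf_brace_linear_head hopf_brace_linear_arg
    hopf_brace_nil hopf_brace_brace.

Lemma mult_exists : exists m : CH_Hopf A 2, forall a c, ceval m [:: a; c] = a ** c.
Proof.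
have [||m mE] := @cochain_exists _ _ A 2 (fun s => head 0 s ** head 0 (behead s)).
- split=> [s _|a]; first by rewrite /=; lin.
  by split=> // s _ /=; lin.
- move=> b [|a [|c [|]]] //= _; rewrite act_prod; apply: eq_lift => b1 b2.
  by rewrite counitr //; lin.
by exists m => a c; apply: (mE [:: a; c]).
Qed.

Definition hopf_mult : CH_Hopf A 2 := sval (cid mult_exists).

Lemma hopf_multE a c : ceval hopf_mult [:: a; c] = a ** c.
Proof. by rewrite /hopf_mult; case: cid. Qed.

Lemma graft_single W n (G : seq A -> W) x s : (size s).+1 = (n + deg x)%N ->
  graft n G [:: x] s = \sum_(i < n) sgn K (sdeg x * (n - i.+1)%N%:Z) *:
    G (take i s ++ ceval (tagged x) (take (deg x) (drop i s)) :: drop (i + deg x) s).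
Proof.
elim: n G s => [|n IH] G s sz; first by rewrite graft0 big_ord0.
rewrite graftS big_ord_recl addrC subn1 /= take0 drop0 add0n graft_nil; last first.
  by rewrite size_drop; lia.
congr (_ + _).
case: s sz => [|a s] sz.
  case: n IH sz => [|n] IH sz; first by rewrite graft0 big_ord0.
  by move: sz => /=; lia.
rewrite IH; last by move: sz => /=; lia.
by apply: eq_bigr.
Qed.

Lemma hopf_mult_graft x s : size s = (deg x).+1 ->
  graft 2 (ceval hopf_mult) [:: x] s =
  head 0 s ** ceval (tagged x) (behead s) +
  sgn K (sdeg x) *: (ceval (tagged x) (take (deg x) s) ** last 0 s).
Proof.
case: s => // a s [sz]; rewrite graft_single /= ?sz // 2!big_ord_recl big_ord0 addr0.
rewrite addrC /= mulr0 mulr1 [sgn K 0]expr0z scale1r drop0 !take0 /= add0n.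
have -> : take (tag x) s = s by rewrite take_oversize ?sz.
have -> : drop (tag x) (a :: s) = [:: last a s].
  rewrite -[last a s]/(last a (a :: s)) -nth_last /= -[tag x]/(deg x) -sz.
  by rewrite (drop_nth a) // drop_oversize.
have -> : drop (tag x) s = [::] by rewrite drop_oversize ?sz.
by rewrite !hopf_multE.
Qed.

Lemma hopf_multP : is_multiplication hopf_brace_algebra hopf_mult.
Proof.
apply: ceval_inj => -[|a [|b [|c [|]]]] // sz.
rewrite [LHS]hopf_braceE // ?hopf_mult_graft //; last by rewrite /balanced big_seq1.
by rewrite /= !hopf_multE [sgn _ _](expr1z (-1 : K)) scaleN1r amulA subrr.
Qed.

(** The outer faces multiply the units at the ends of 1 (x) a_1 (x) ... (x) 1 by
    a_1 and a_(n+1), which f lets out. *)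
Lemma ceval_cdiff n (f : CH_Hopf A n) s : size s = n.+1 ->
  ceval (cdiff f) s = head 0 s ** ceval f (behead s) +
  \sum_(i < n) (-1) ^+ i.+1 *:
    ceval f (take i s ++ nth 0 s i ** nth 0 s i.+1 :: drop i.+2 s) +
  (-1) ^+ n.+1 *: (ceval f (take n s) ** last 0 s).
Proof.
move=> sz; have lf := (cochainP f).1.
have -> : ceval (cdiff f) s =
    cochain_val f (dCB (tpures n.+2 (aone :: rcons s aone))) by [].
set S := aone :: rcons s aone.
have zS : size S = n.+3 by rewrite /= size_rcons sz.
have -> : cochain_val f (dCB (tpures n.+2 S)) = \sum_(j < n.+2) (-1) ^+ j *:
    cochain_val f (tpures n.+1 (take j S ++ nth 0 S j ** nth 0 S j.+1 :: drop j.+2 S)).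
  rewrite /dCB (lin_sum _ _ _ lf); apply: eq_bigr => j _.
  by rewrite (linZ _ _ lf) face_tpures // -ltnS.
rewrite big_ord_recl big_ord_recr expr0 scale1r addrA; congr (_ + _ + _).
- case: s sz @S {zS} => // a s [sz] /=.
  by rewrite drop0 amul1a [LHS]cochain_tpures // amula1.
- apply: eq_bigr => i _; have ltin := ltn_ord i; rewrite lift0 /ceval.
  apply: (congr1 (fun l => (-1) ^+ i.+1 *: cochain_val f (tpures n.+1 l))).
  have li : (i <= size s)%N by lia.
  rewrite rcons_cat rcons_cons /S -drop_rcons ?sz // /=.
  by rewrite -cats1 takel_cat // !nth_cat sz !ltnS (ltnW ltin) ltin.
rewrite lift0; congr (_ *: _); clear zS; move: @S.
case/lastP: s sz => // s c; rewrite size_rcons last_rcons => -[sz] S.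
have -> : take n.+1 S ++ S`_n.+1 ** S`_n.+2 :: drop n.+3 S = aone :: rcons s c.
  rewrite /S /= !nth_rcons !size_rcons sz.
  rewrite ltnSn !ltnn !eqxx amula1.
  by rewrite drop_oversize ?size_rcons ?sz // -!cats1 -catA take_size_cat.
by rewrite cochain_tpures // amul1a -cats1 take_size_cat.
Qed.

(** Up to the sign - (-1)^|f| the inner faces sum up to f{m}; the two outer faces
    sum up to m{f}. *)
Lemma hopf_diff n (f : CH_Hopf A n) :
  cdiff f = brace_diff hopf_brace_algebra hopf_mult f.
Proof.
apply: ceval_inj => s sz; rewrite ceval_cdiff // /brace_diff.
have -> : ceval (brace hopf_brace_algebra (hom hopf_mult) [:: hom f] n.+1 -
    (-1) ^ sdeg (hom f) *: brace hopf_brace_algebra (hom f) [:: hom hopf_mult] n.+1) s =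
  ceval (hopf_brace (hom hopf_mult) [:: hom f] n.+1) s -
  sgn K (sdeg (hom f)) *: ceval (hopf_brace (hom f) [:: hom hopf_mult] n.+1) s by [].
rewrite !hopf_braceE /balanced ?big_seq1 ?addn1 ?addn2 //.
rewrite hopf_mult_graft // graft_single /= ?sz ?addn2 //.
rewrite [RHS]addrAC; congr (_ + _ + _); last first.
  rewrite -sgn_nat -(sgn_double _ (sdeg (hom f)) 1); congr (sgn K _ *: _).
  by have -> : sdeg (hom f) = n%:Z - 1 by []; lia.
rewrite -scaleNr scaler_sumr; apply: eq_bigr => i _; have ltin := ltn_ord i.
rewrite (drop_nth 0 (n := i)) ?(drop_nth 0 (n := i.+1)) ?sz /=; [|lia..].
rewrite take0 hopf_multE addn2 scalerA mulNr -sgnD; congr (_ *: _).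
rewrite sgn_opp -sgn_nat -(sgn_double _ i.+1%:Z (n - i.+1)%N%:Z); congr (sgn K _).
have -> : sdeg (hom f) = n%:Z - 1 by [].
by have -> : sdeg (hom hopf_mult) = 1 by []; lia.
Qed.

Definition hopf_ms_algebra : mcClureSmithAlgebra (CH_Hopf A) :=
  McClureSmithAlgebra hopf_multP hopf_diff.

End HopfBraces.

Theorem corollary7p1 (K : fieldType) (H : bialgType K) (A : modAlgType H) :
  exists S : mcClureSmithAlgebra (CH_Hopf A),
    (forall a b : A, ceval (ms_mult S) [:: a; b] = a ** b) /\
    (forall (x : helt (CH_Hopf A)) (xs : seq (helt (CH_Hopf A))) (N : nat)
        (s : seq A),
      (N + size xs)%N = (deg x + \sum_(y <- xs) deg y)%N -> size s = N ->
      ceval (brace (ms_brace S) x xs N) s = compose x xs s).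
Proof.
exists (hopf_ms_algebra A); split=> [a b|x xs N s].
  exact: hopf_multE.
exact: hopf_braceE.
Qed.
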